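(* Let $(\pi,N)$ be a Poisson–Nijenhuis structure on a Lie algebroid $(A,[\cdot,\cdot],\rho)$. Then the derivation $\underline N$ is weak Nijenhuis with respect to the $L_\infty$-structure $l_1^{[\cdot,\cdot],\pi}+l_2^{[\cdot,\cdot]}$ on $\Gamma(\wedge A)[2]$ associated to the Poisson structure $\pi$ (and the Lie algebroid $A$). In this case, the deformed structure $[\underline N,\,l_1^{[\cdot,\cdot],\pi}+l_2^{[\cdot,\cdot]}]_{RN}$ is the $L_\infty$-structure associated to the Poisson structure $-\pi_N$ on the Lie algebroid $(A,[\cdot,\cdot]_N,\rho^N)$.
   Context: $(A,[\cdot,\cdot],\rho)$ is a Lie algebroid over $M$ with differential $\mathrm d^A$ and Lie derivatives $\mathcal L^A$. For a bi-vector $\pi\in\Gamma(\wedge^2A)$ (with $(X\wedge Y)(\alpha,\beta)=\alpha(X)\beta(Y)-\alpha(Y)\beta(X)$), $\pi^\#:\Gamma(A^* )\to\Gamma(A)$ is given by $\langle\beta,\pi^\#\alpha\rangle=\pi(\alpha,\beta)$. For a $(1,1)$-tensor field $N$ ($C^\infty(M)$-linear $\Gamma(A)\to\Gamma(A)$), $\langle N^*\alpha,X\rangle=\langle\alpha,NX\rangle$, $[X,Y]_N=[NX,Y]+[X,NY]-N[X,Y]$, $\rho^N=\rho\circ N$, and $\pi_N(\alpha,\beta)=\langle\beta,N\pi^\#\alpha\rangle$. For a (pre-)Lie algebroid bracket $m$ on $A$ put $\{\alpha,\beta\}_\pi^{m}=\mathcal L_{\pi^\#\alpha}\beta-\mathcal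 L_{\pi^\#\beta}\alpha-\mathrm d(\pi(\alpha,\beta))$, with $\mathcal L,\mathrm d$ those of $m$. $(\pi,N)$ is a Poisson–Nijenhuis structure if: (1) $N$ is Nijenhuis, $[NX,NY]=N([X,Y]_N)$; (2) $\pi$ is Poisson, $[\pi,\pi]_{SN}=0$; (3) $N\pi^\#=\pi^\#N^*$; (4) $\{N^*\alpha,\beta\}_\pi+\{\alpha,N^*\beta\}_\pi-N^*\{\alpha,\beta\}_\pi=\{\alpha,\beta\}^{N}_\pi$ for all $\alpha,\beta\in\Gamma(A^* )$, where $\{\cdot,\cdot\}_\pi$ is computed with $([\cdot,\cdot],\rho)$ and $\{\cdot,\cdot\}^N_\pi$ with $([\cdot,\cdot]_N,\rho\circ N)$. $\Gamma(\wedge A)[2]$: elements of $\Gamma(\wedge^pA)$ have degree $p-2$. Extension by derivation: $\underline N(f)=0$ for functions, $\underline N(P_1\wedge\cdots\wedge P_p)=\sum_iP_1\wedge\cdots\wedge N(P_i)\wedge\cdots\wedge P_p$. The Schouten–Nijenhuis bracket of a Lie algebroid is the unique bilinear bracket on $\Gamma(\wedge A)$ with $[X,f]_{SN}=\rho(X)f$, $[X,Y]_{SN}=[X,Y]$ for $X,Y\in\Gamma(A)$, $[f,g]_{SN}=0$ for functions, and for $P\in\Gamma(\wedge^{p}A)$, $Q\in\Gamma(\wedge^qA)$: $[P,Q]_{SN}=-(-1)^{(p-1)(q-1)}[Q,P]_{SN}$, $[P,Q\wedge R]_{SN}=[P,Q]_{SN}\wedge R+(-1)^{(p-1)q}Q\wedge[P,R]_{SN}$.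 For any Lie algebroid $(A,[\cdot,\cdot],\rho)$ and Poisson bi-vector $\pi$ on it, the $L_\infty$-structure associated to $\pi$ and the Lie algebroid is $l_1^{[\cdot,\cdot],\pi}+l_2^{[\cdot,\cdot]}$ on $\Gamma(\wedge A)[2]$, where $l_1^{[\cdot,\cdot],\pi}(P)=[\pi,P]_{SN}$ and $l_2^{[\cdot,\cdot]}(P,Q)=(-1)^{p-1}[P,Q]_{SN}$ for $P\in\Gamma(\wedge^pA)$, $Q\in\Gamma(\wedge^qA)$, with the Schouten–Nijenhuis bracket of that Lie algebroid. (An $L_\infty$-structure is a sum $\mu=\sum_{i\ge1}l_i$ of symmetric vector valued $i$-forms of degree $+1$ with $[\mu,\mu]_{RN}=0$.) On a graded vector space, a symmetric vector valued $k$-form is a graded symmetric $k$-linear map $K$ (exchanging adjacent arguments $X,Y$ gives $(-1)^{|X||Y|}$), of degree $\bar K$ if $|K(X_1,\dots,X_k)|=\sum|X_i|+\bar K$. For a $k$-form $K$ and $l$-form $L$, $$\iota_KL(X_1,\dots,X_{k+l-1})=\sum_{\sigma\in Sh(k,l-1)}\epsilon(\sigma)L(K(X_{\sigma(1)},\dots,X_{\sigma(k)}),X_{\sigma(k+1)},\dots,X_{\sigma(k+l-1)})$$ (unshuffles, Koszul sign), and $[K,L]_{RN}=\iota_KL-(-1)^{\bar K\bar L}\iota_LK$, extended bilinearly. For $\mu$ of degree $1$, a form $\mathcal N$ of degree $0$ is weak Nijenhuis with respect to $\mu$ if $[\mu,[\mathcal N,[\mathcal N,\mu]_{RN}]_{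RN}]_{RN}=0$.
   Formalization: The deformed structure is not that of −π_N on (A,[·,·]_N,ρ^N) (fails for N=2id, π=∂x∧∂y); it is proved instead that it equals l_1^{[·,·],−π_N}+l_2^{[·,·]_N}, i.e. the L∞-structure associated to −π on (A,[·,·]_N,ρ^N). *)

(* Defs.v *)
From HB Require Import structures.
From mathcomp Require Import all_boot all_order all_algebra all_fingroup.
From mathcomp Require Import boolp classical_sets functions reals ring.

Set Implicit Arguments.
Unset Strict Implicit.
Unset Printing Implicit Defensive.

Import GRing.Theory.
Local Open Scope ring_scope.

(* A Lie algebroid A -> M enters through the R-algebra C = C^oo(M), the       *)
(* C-module L = Gamma(A) (finitely generated projective, by Serre-Swan), the  *)
(* bracket br on L and the anchor rho, rho X f being the derivative of f      *)
(* along the anchor of X.                                                     *)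

Section LieAlgebroids.
Variables (R : realType) (C : comAlgType R) (L : lmodType C).

Definition fg_projective : Prop :=
  exists (n : nat) (i : {linear L -> 'rV[C]_n}) (p : {linear 'rV[C]_n -> L}),
    cancel i p.

Record pre_lie_algebroid (br : L -> L -> L) (rho : L -> C -> C) : Prop := {
  pla_br_linear : forall (c : R) X Y Z,
    br (c%:A *: X + Y) Z = c%:A *: br X Z + br Y Z;
  pla_br_skew : forall X Y, br X Y = - br Y X;
  pla_rho_linear : forall f X Y g, rho (f *: X + Y) g = f * rho X g + rho Y g;
  pla_rho_scalar : forall X (c : R) f g, rho X (c *: f + g) = c *: rho X f + rho X g;
  pla_rho_derivation : forall X f g, rho X (f * g) = rho X f * g + f * rho X g;
  pla_leibniz : forall X Y f, br X (f *: Y) = f *: br X Y + rho X f *: Y }.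

Record lie_algebroid (br : L -> L -> L) (rho : L -> C -> C) : Prop := {
  la_pre : pre_lie_algebroid br rho;
  la_jacobi : forall X Y Z, br X (br Y Z) + br Y (br Z X) + br Z (br X Y) = 0;
  la_anchor : forall X Y f,
    rho (br X Y) f = rho X (rho Y f) - rho Y (rho X f) }.

Definition deformed_br (br : L -> L -> L) (N : {linear L -> L}) (X Y : L) : L :=
  br (N X) Y + br X (N Y) - N (br X Y).

Definition deformed_anchor (rho : L -> C -> C) (N : {linear L -> L})
  (X : L) (f : C) : C := rho (N X) f.

Definition nijenhuis (br : L -> L -> L) (N : {linear L -> L}) : Prop :=
  forall X Y, br (N X) (N Y) = N (deformed_br br N X Y).

(* Gamma(A^* ) *)
Definition dual : Type := {linear L -> C^o}.

Definition transp (N : {linear L -> L}) (alpha : dual) : dual := alpha \o N.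

(* An element of Gamma(wedge A) is the family of its homogeneous components,  *)
(* alternating C-multilinear forms on Gamma(A^* ); the component in           *)
(* Gamma(wedge^p A) is the restriction to sequences of size p.  Skew-symmetry *)
(* amounts to alternation since C is an algebra over the reals.               *)
Definition is_multivector (P : seq dual -> C) : Prop :=
  [/\ forall s t (f : C) (a b : dual),
        P (s ++ ((f \*: a) \+ b : dual) :: t) = f * P (s ++ a :: t) + P (s ++ b :: t),
      forall s t (a b : dual), P (s ++ a :: b :: t) = - P (s ++ b :: a :: t)
    & exists m : nat, forall s, (m < size s)%N -> P s = 0].

Definition multivector_pred : {pred (seq dual -> C)} :=
  fun P => `[< is_multivector P >].

Lemma multivector_submod_closed : submod_closed multivector_pred.
Proof.
split=> [|c P Q /asboolP[Pl Ps [m Pm]] /asboolP[Ql Qs [n Qn]]].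
  by apply/asboolP; split=> *; rewrite ?mulr0 ?addr0 ?oppr0 //; exists 0%N.
apply/asboolP; split.
- move=> s t f a b; rewrite !fctE Pl Ql scalerDr scalerAr mulrDr !addrA.
  by congr (_ + _); rewrite -!addrA; congr (_ + _); rewrite addrC.
- by move=> s t a b; rewrite !fctE Ps Qs scalerN opprD.
exists (maxn m n) => s; rewrite gtn_max => /andP[ms ns].
by rewrite !fctE Pm ?Qn // scaler0 addr0.
Qed.

HB.instance Definition _ :=
  GRing.isSubmodClosed.Build R (seq dual -> C) multivector_pred
    multivector_submod_closed.

Record multivector : Type := Multivector {
  mvval :> seq dual -> C;
  mvvalP : mvval \in multivector_pred }.

HB.instance Definition _ := [isSub for mvval].
HB.instance Definition _ := [Choice of multivector by <:].
HB.instance Definition _ := [SubChoice_isSubLmodule of multivector by <:].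


Lemma multivector_of (P : seq dual -> C) :
  is_multivector P -> P \in multivector_pred.
Proof. by move=> hP; apply/asboolP. Qed.

Lemma is_multivectorP (P : multivector) : is_multivector P.
Proof. by apply/asboolP/(mvvalP P). Qed.

(* Gamma(wedge^p A) *)
Definition homogeneous (p : nat) (P : multivector) : Prop :=
  forall s, size s != p -> P s = 0.

Lemma mv_fun_subproof (f : C) :
  (fun s : seq dual => if s is [::] then f else 0) \in multivector_pred.
Proof.
apply: multivector_of; split.
- by move=> [|? ?] t g a b /=; rewrite mulr0 addr0.
- by move=> [|? ?] t a b /=; rewrite oppr0.
by exists 0%N; case.
Qed.

Definition mv_fun (f : C) : multivector := Multivector (mv_fun_subproof f).

Lemma mv_vec_subproof (X : L) :
  (fun s : seq dual => if s is [:: a] then a X else 0) \in multivector_pred.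
Proof.
apply: multivector_of; split.
- move=> [|c [|d s]] [|e t] f a b //=; by rewrite mulr0 addr0.
- by move=> [|c [|d s]] t a b /=; rewrite oppr0.
by exists 1%N; case=> [|a [|b s]].
Qed.

(* Gamma(A) -> Gamma(wedge^1 A), X |-> <-, X> *)
Definition mv_vec (X : L) : multivector := Multivector (mv_vec_subproof X).

Lemma parity_part_subproof (odd_part : bool) (P : multivector) :
  (fun s => if odd (size s) == odd_part then P s else 0) \in multivector_pred.
Proof.
have [Pl Ps [m Pm]] := is_multivectorP P.
apply: multivector_of; split.
- move=> s t f a b; rewrite !size_cat /= Pl; case: ifP => // _.
  by rewrite mulr0 addr0.
- by move=> s t a b; rewrite !size_cat /= Ps; case: ifP => // _; rewrite oppr0.
by exists m => s /Pm ->; rewrite if_same.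
Qed.

Definition parity_part (odd_part : bool) (P : multivector) : multivector :=
  Multivector (parity_part_subproof odd_part P).

(* The wedge product of alternating forms,                                    *)
(*   (P /\ Q)(a_1, .., a_n) =                                                 *)
(*     \sum_(unshuffles s) sgn(s) P(a_s(1), .., a_s(p)) Q(a_s(p+1), .., a_s(n)),*)
(* computed by deciding for each argument in turn whether it goes to P or,    *)
(* past the remaining arguments of P, to Q.                                   *)
Fixpoint wedge_form (P Q : seq dual -> C) (s : seq dual) : C :=
  if s is a :: s' then
    wedge_form (fun t => P (a :: t)) Q s' +
    wedge_form (fun t => (-1) ^+ size t * P t) (fun t => Q (a :: t)) s'
  else P [::] * Q [::].

Lemma wedge_form_linl (P P1 P2 Q : seq dual -> C) f s :
  (forall t, P t = f * P1 t + P2 t) ->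
  wedge_form P Q s = f * wedge_form P1 Q s + wedge_form P2 Q s.
Proof.
elim: s P P1 P2 Q => [|a s IH] P P1 P2 Q eP /=; first by rewrite eP mulrDl mulrA.
rewrite (IH (fun t => P (a :: t)) (fun t => P1 (a :: t)) (fun t => P2 (a :: t))) //.
rewrite (IH (fun t => (-1) ^+ size t * P t)
  (fun t => (-1) ^+ size t * P1 t) (fun t => (-1) ^+ size t * P2 t)).
  by rewrite mulrDr addrACA.
by move=> t; rewrite eP mulrDr mulrCA.
Qed.

Lemma wedge_form_linr (P Q Q1 Q2 : seq dual -> C) f s :
  (forall t, Q t = f * Q1 t + Q2 t) ->
  wedge_form P Q s = f * wedge_form P Q1 s + wedge_form P Q2 s.
Proof.
elim: s P Q Q1 Q2 => [|a s IH] P Q Q1 Q2 eQ /=; first by rewrite eQ mulrDr mulrCA.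
rewrite (IH _ Q Q1 Q2) //.
rewrite (IH _ (fun t => Q (a :: t)) (fun t => Q1 (a :: t)) (fun t => Q2 (a :: t))) //.
by rewrite mulrDr addrACA.
Qed.

Lemma wedge_form0l (Q : seq dual -> C) s : wedge_form (fun=> 0) Q s = 0.
Proof.
apply: (addrI (wedge_form (fun=> 0) Q s)); rewrite addr0.
rewrite -[X in X + _ = _]mul1r; apply/esym.
by apply: wedge_form_linl => t; rewrite mulr0 addr0.
Qed.

Lemma wedge_formNl (P P1 Q : seq dual -> C) s :
  (forall t, P t = - P1 t) -> wedge_form P Q s = - wedge_form P1 Q s.
Proof.
move=> eP; rewrite (@wedge_form_linl P P1 (fun=> 0) Q (-1)) => [|t].
  by rewrite wedge_form0l addr0 mulN1r.
by rewrite addr0 mulN1r.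
Qed.

Lemma wedge_form0r (P : seq dual -> C) s : wedge_form P (fun=> 0) s = 0.
Proof.
apply: (addrI (wedge_form P (fun=> 0) s)); rewrite addr0.
rewrite -[X in X + _ = _]mul1r; apply/esym.
by apply: wedge_form_linr => t; rewrite mulr0 addr0.
Qed.

Lemma wedge_formNr (P Q Q1 : seq dual -> C) s :
  (forall t, Q t = - Q1 t) -> wedge_form P Q s = - wedge_form P Q1 s.
Proof.
move=> eQ; rewrite (@wedge_form_linr P Q Q1 (fun=> 0) (-1)) => [|t].
  by rewrite wedge_form0r addr0 mulN1r.
by rewrite addr0 mulN1r.
Qed.

Lemma wedge_form_multivector (P Q : seq dual -> C) :
  is_multivector P -> is_multivector Q -> is_multivector (wedge_form P Q).
Proof.
have cons_mv a F : is_multivector F -> is_multivector (fun t => F (a :: t)).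
  move=> [Fl Fs [m Fm]]; split=> [s t|s t|].
  - exact: (Fl (a :: s)).
  - exact: (Fs (a :: s)).
  by exists m => s ms; apply: Fm; apply: leqW.
have sign_mv F : is_multivector F ->
    is_multivector (fun t => (-1) ^+ size t * F t).
  move=> [Fl Fs [m Fm]]; split=> [s t f a b|s t a b|].
  - by rewrite !size_cat /= Fl mulrDr mulrCA.
  - by rewrite !size_cat /= Fs mulrN.
  by exists m => s /Fm ->; rewrite mulr0.
move=> hP hQ; split.
- move=> s; elim: s P Q hP hQ => [|c s IH] P Q hP hQ t f a b /=; last first.
    have ? := cons_mv c _ hP; have ? := cons_mv c _ hQ; have ? := sign_mv _ hP.
    by rewrite (IH (fun t => P (c :: t)) Q) // (IH _ (fun t => Q (c :: t))) //
      mulrDr addrACA.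
  have [Pl _ _] := hP; have [Ql _ _] := hQ.
  rewrite (@wedge_form_linl (fun t => P (((f \*: a) \+ b : dual) :: t)) (fun t => P (a :: t)) (fun t => P (b :: t)) _ f);
    last by move=> u; apply: (Pl [::]).
  rewrite (@wedge_form_linr _ (fun t => Q (((f \*: a) \+ b : dual) :: t)) (fun t => Q (a :: t)) (fun t => Q (b :: t)) f);
    last by move=> u; apply: (Ql [::]).
  by rewrite mulrDr addrACA.
- move=> s; elim: s P Q hP hQ => [|c s IH] P Q hP hQ t a b /=; last first.
    have ? := cons_mv c _ hP; have ? := cons_mv c _ hQ; have ? := sign_mv _ hP.
    by rewrite (IH (fun t => P (c :: t)) Q) // (IH _ (fun t => Q (c :: t))) //
      -opprD.
  have [_ Ps _] := hP; have [_ Qs _] := hQ.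
  rewrite (@wedge_formNl (fun u => P (a :: b :: u)) (fun u => P (b :: a :: u)));
    last by move=> u; exact: (Ps [::] u a b).
  rewrite (@wedge_formNr _ (fun u => Q (a :: b :: u)) (fun u => Q (b :: a :: u)));
    last by move=> u; exact: (Qs [::] u a b).
  have sgn c u : (-1) ^+ size (c :: u) * P (c :: u) =
      - ((-1) ^+ size u * P (c :: u)) :> C.
    by rewrite /= exprS mulN1r mulNr.
  rewrite (@wedge_formNl (fun u => (-1) ^+ size (b :: u) * P (b :: u))
             (fun u => (-1) ^+ size u * P (b :: u))); last by move=> u; exact: sgn.
  rewrite [in RHS](@wedge_formNl (fun u => (-1) ^+ size (a :: u) * P (a :: u))
             (fun u => (-1) ^+ size u * P (a :: u))); last by move=> u; exact: sgn.
  rewrite !opprD !opprK -!addrA; congr (_ + _).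
  by rewrite [RHS]addrCA.
have [_ _ [m Pm]] := hP; have [_ _ [n Qn]] := hQ.
exists (m + n)%N => s.
elim: s P Q m n Pm Qn {hP hQ} => [|c s IH] P Q m n Pm Qn //= mns.
rewrite [X in X + _](_ : _ = 0) ?add0r; last first.
  case: m Pm mns => [|m] Pm mns.
    have -> : (fun t => P (c :: t)) = (fun=> 0) by apply/funext => t; rewrite Pm.
    exact: wedge_form0l.
  by apply: (IH _ _ m n) => // t mt; apply: Pm.
case: n Qn mns => [|n] Qn mns.
  have -> : (fun t => Q (c :: t)) = (fun=> 0) by apply/funext => t; rewrite Qn.
  exact: wedge_form0r.
apply: (IH _ _ m n) => [t mt|t nt|].
- by rewrite Pm ?mulr0.
- exact: Qn.
by rewrite addnS in mns.
Qed.

Definition wedge (P Q : multivector) : multivector :=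
  Multivector (multivector_of
    (wedge_form_multivector (is_multivectorP P) (is_multivectorP Q))).

Lemma wedge_vec (X Y : L) (a b : dual) :
  wedge (mv_vec X) (mv_vec Y) [:: a; b] = a X * b Y - a Y * b X.
Proof. by rewrite /=; ring. Qed.

Definition wedge_vecs (Xs : seq L) : multivector :=
  foldr (fun X => wedge (mv_vec X)) (mv_fun 1) Xs.

(* In the signs, p.+1 stands for p - 1, which has the same parity.            *)
Record is_schouten (br : L -> L -> L) (rho : L -> C -> C)
    (S : multivector -> multivector -> multivector) : Prop := {
  sn_linearl : forall (c : R) P Q T, S (c *: P + Q) T = c *: S P T + S Q T;
  sn_linearr : forall (c : R) P Q T, S T (c *: P + Q) = c *: S T P + S T Q;
  sn_fun_fun : forall f g, S (mv_fun f) (mv_fun g) = 0;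
  sn_vec_fun : forall X f, S (mv_vec X) (mv_fun f) = mv_fun (rho X f);
  sn_vec_vec : forall X Y, S (mv_vec X) (mv_vec Y) = mv_vec (br X Y);
  sn_skew : forall p q P Q, homogeneous p P -> homogeneous q Q ->
    S P Q = - ((-1) ^+ (p.+1 * q.+1) *: S Q P);
  sn_leibniz : forall p q P Q T, homogeneous p P -> homogeneous q Q ->
    S P (wedge Q T) =
      wedge (S P Q) T + (-1) ^+ (p.+1 * q) *: wedge Q (S P T) }.

Definition schouten (br : L -> L -> L) (rho : L -> C -> C) :
    multivector -> multivector -> multivector :=
  xget (fun _ _ => 0) [set S | is_schouten br rho S].

Definition poisson (br : L -> L -> L) (rho : L -> C -> C) (pi : multivector) : Prop :=
  homogeneous 2 pi /\ schouten br rho pi pi = 0.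

(* pi^# a is the section X with <b, X> = pi(a, b) for all b. *)
Definition sharp (pi : multivector) (a : dual) : L :=
  xget 0 [set X | forall b : dual, b X = pi [:: a; b]].

(* The bi-vector pi_N. *)
Definition bivector_N (pi : multivector) (N : {linear L -> L}) : multivector :=
  xget 0 [set Q | homogeneous 2 Q /\
                  forall a b : dual, Q [:: a; b] = b (N (sharp pi a))].

Definition lie_derivative (br : L -> L -> L) (rho : L -> C -> C)
  (X : L) (a : dual) (Y : L) : C := rho X (a Y) - a (br X Y).

(* The one-form {a, b}_pi = L_(pi^# a) b - L_(pi^# b) a - d(pi(a, b)). *)
Definition koszul_bracket (br : L -> L -> L) (rho : L -> C -> C)
    (pi : multivector) (a b : dual) (X : L) : C :=
  lie_derivative br rho (sharp pi a) b X - lie_derivative br rho (sharp pi b) a X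
  - rho X (pi [:: a; b]).

Record poisson_nijenhuis (br : L -> L -> L) (rho : L -> C -> C)
    (pi : multivector) (N : {linear L -> L}) : Prop := {
  pn_nijenhuis : nijenhuis br N;
  pn_poisson : poisson br rho pi;
  pn_sharp : forall a, N (sharp pi a) = sharp pi (transp N a);
  pn_compat : forall a b X,
    koszul_bracket br rho pi (transp N a) b X
    + koszul_bracket br rho pi a (transp N b) X
    - koszul_bracket br rho pi a b (N X)
    = koszul_bracket (deformed_br br N) (deformed_anchor rho N) pi a b X }.

Record is_derivation_extension (N : {linear L -> L})
    (D : multivector -> multivector) : Prop := {
  de_linear : forall (c : R) P Q, D (c *: P + Q) = c *: D P + D Q;
  de_fun : forall f, D (mv_fun f) = 0;
  de_wedge : forall Xs : seq L,
    D (wedge_vecs Xs) =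
      \sum_(i < size Xs) wedge_vecs (set_nth 0 Xs i (N (nth 0 Xs i))) }.

Definition derivation_extension (N : {linear L -> L}) : multivector -> multivector :=
  xget (fun=> 0) [set D | is_derivation_extension N D].

(* The graded vector space Gamma(wedge A)[2]: degree p - 2 on Gamma(wedge^p A). *)
Definition has_degree (d : int) (P : multivector) : Prop :=
  forall s, (size s)%:Z - 2 != d -> P s = 0.

(* A formal sum of vector valued k-forms on Gamma(wedge A)[2]; its k-form     *)
(* component is the restriction to sequences of size k.                       *)
Definition vform : Type := seq multivector -> multivector.

Record is_symmetric_vform (e : int) (K : vform) : Prop := {
  vf_linear : forall s t (c : R) P Q,
    K (s ++ (c *: P + Q) :: t) = c *: K (s ++ P :: t) + K (s ++ Q :: t);
  vf_symmetric : forall s t (d d' : int) P Q, has_degree d P -> has_degree d' Q ->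
    K (s ++ P :: Q :: t) = (-1) ^ (d * d') *: K (s ++ Q :: P :: t);
  vf_degree : forall (ds : seq int) (Ps : seq multivector), size ds = size Ps ->
    (forall i, (i < size Ps)%N -> has_degree (nth 0 ds i) (nth 0 Ps i)) ->
    has_degree (\sum_(d <- ds) d + e) (K Ps) }.

(* The Koszul sign; odd_deg i is the parity of the degree of the i-th argument. *)
Definition koszul_sign (n : nat) (odd_deg : 'I_n -> bool) (s : 'S_n) : R :=
  \prod_(i < n) \prod_(j < n | (i < j)%N && (s j < s i)%N)
    (-1) ^+ (odd_deg (s i) && odd_deg (s j)).

Definition is_unshuffle (n k : nat) (s : 'S_n) : bool :=
  [forall i : 'I_n, forall j : 'I_n,
    (i < j)%N && ((j < k)%N || (k <= i)%N) ==> (s i < s j)%N].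

(* iota_K F.  Koszul signs depend only on the parities of the degrees, so the *)
(* arguments are split into even and odd parts (p - 2 has the parity of p);   *)
(* on homogeneous arguments a single term of the sum over o survives.         *)
Definition insertion (K F : vform) : vform := fun Ps =>
  \sum_(o : {ffun 'I_(size Ps) -> bool})
  \sum_(k < (size Ps).+1)
  \sum_(s : 'S_(size Ps) | is_unshuffle k s)
    let Qs := [seq parity_part (o (s i)) (nth 0 Ps (s i)) | i <- enum 'I_(size Ps)] in
    koszul_sign o s *: F (K (take k Qs) :: drop k Qs).

(* [K, F]_RN for K of degree dK and F of degree dF. *)
Definition rn_bracket (dK dF : int) (K F : vform) : vform := fun Ps =>
  insertion K F Ps - (-1) ^ (dK * dF) *: insertion F K Ps.

Definition linfty_structure (mu : vform) : Prop :=
  [/\ is_symmetric_vform 1 mu, mu [::] = 0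
    & forall Ps, rn_bracket 1 1 mu mu Ps = 0].

Definition weak_nijenhuis (mu NN : vform) : Prop :=
  is_symmetric_vform 0 NN /\
  forall Ps, rn_bracket 1 1 mu (rn_bracket 0 1 NN (rn_bracket 0 1 NN mu)) Ps = 0.

Definition unary_form (D : multivector -> multivector) : vform :=
  fun Ps => if Ps is [:: P] then D P else 0.

Definition l1 (br : L -> L -> L) (rho : L -> C -> C) (pi : multivector) : vform :=
  unary_form (schouten br rho pi).

(* (-1)^(p-1) is 1 on the odd part and -1 on the even part of Gamma(wedge A). *)
Definition l2 (br : L -> L -> L) (rho : L -> C -> C) : vform := fun Ps =>
  if Ps is [:: P; Q] then
    schouten br rho (parity_part true P) Q - schouten br rho (parity_part false P) Q
  else 0.

Definition associated_linfty (br : L -> L -> L) (rho : L -> C -> C)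
  (pi : multivector) : vform := l1 br rho pi \+ l2 br rho.

End LieAlgebroids.

(* Main.v *)
(* The Schouten bracket of a Lie algebroid is constructed from a torsion-free
   connection, which exists since Gamma(A) is finitely generated projective; as
   multivectors are generated by functions and sections, it is unique and its
   graded Jacobi identity only has to be checked on generators.  The latter
   makes l_1 + l_2 an L_infinity-structure.

   Uniqueness gives [P, Q]_N = [N P, Q] + [P, N Q] - N [P, Q] for the underlined
   N, hence [N, l_2] is the l_2 of [.,.]_N.  Condition (4) says that the brackets
   {.,.}_(pi_N) and {.,.}_pi^N agree, hence [pi_N, P] = [pi, P]_N for all P.
   Together with N pi = 2 pi_N this gives [N, l_1] = - [pi_N, .] = - [pi, .]_N.
   So bracketing with N turns the structure of (A, pi) into that of (A_N, -pi),
   and since (-pi, N) is again Poisson-Nijenhuis on A_N, bracketing twice gives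
   the structure of (A_(N^2), pi).  Finally [.,.] + [.,.]_(N^2) is a Lie algebroid
   bracket for which pi is Poisson, so the structures of (A, pi) and
   (A_(N^2), pi) commute: this is the weak Nijenhuis condition. *)
Require Import Defs.
From HB Require Import structures.
From mathcomp Require Import all_boot all_order all_algebra all_fingroup.
From mathcomp Require Import boolp classical_sets functions reals ring.

Set Implicit Arguments.
Unset Strict Implicit.
Unset Printing Implicit Defensive.

Import GRing.Theory Num.Theory.
Local Open Scope ring_scope.

(** * Derivations of multivectors *)

Section Multivectors.
Variables (R : realType) (C : comAlgType R) (L : lmodType C).
Local Notation dual := (dual L).
Local Notation form := (seq dual -> C).
Local Notation mv := (multivector L).
Implicit Types (F G H : form) (P Q T : mv) (a b : dual) (s t : seq dual).

(** Identities for [pi, .] are reduced by derivation rules to functions and sections. There [pi, .]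
    is given by the anchor of pi^# and by the Koszul bracket, so the Poisson-Nijenhuis conditions
    become identities between sections; paired with an arbitrary one-form, these are ring identities
    in C.

    Signs see degrees only through their parity. Multivectors are therefore sorted by a Boolean
    ([pure]), and a graded identity splits into finitely many cases without exponents.

    The connection serves twice: it gives existence of the Schouten bracket, and it computes the
    bracket on bivectors, where vanishing torsion trades covariant derivatives for brackets of
    sections.

    The obstacle to bracketing twice with N is that [-pi_N, .] belongs to the bracket of A while the
    binary part belongs to A_N, so this description is not of the associated form. Rewriting the
    unary part as [-pi, .]_N restores that form and makes the computation repeatable.

    Division by 2 recurs: in the torsion-free connection, in the polarised [pi, pi], and in
    condition (4), which yields only twice the concomitant. *)

Lemma dual_ext a b : (forall X, a X = b X) -> a = b.
Proof.
case: a b => a [[a1] [a2]] [b [[b1] [b2]]] /= ab.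
have {}ab : a = b by apply/funext.
subst b; do 2 f_equal; f_equal; exact: Prop_irrelevance.
Qed.

Lemma mv_ext P Q : (forall s, P s = Q s) -> P = Q.
Proof. by move=> PQ; apply/val_inj/funext. Qed.

Lemma mvD P Q s : (P + Q) s = P s + Q s. Proof. by []. Qed.
Lemma mvN P s : (- P) s = - P s. Proof. by []. Qed.
Lemma mv0 s : (0 : mv) s = 0. Proof. by []. Qed.
Lemma mvZ (c : R) P s : (c *: P) s = c *: P s. Proof. by []. Qed.
Lemma mvsum I (r : seq I) (p : pred I) (f : I -> mv) s :
  (\sum_(i <- r | p i) f i) s = \sum_(i <- r | p i) f i s.
Proof. exact: (big_morph (fun P : mv => P s)). Qed.

Definition mvE := (mvD, mvN, mv0, mvZ, mvsum).

Definition mv_lin F :=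
  forall s t (f : C) a b,
    F (s ++ ((f \*: a) \+ b : dual) :: t) = f * F (s ++ a :: t) + F (s ++ b :: t).
Definition mv_skew F :=
  forall s t a b, F (s ++ a :: b :: t) = - F (s ++ b :: a :: t).
Lemma mv_linP P : mv_lin P. Proof. by case: (is_multivectorP P). Qed.
Lemma mv_skewP P : mv_skew P. Proof. by case: (is_multivectorP P). Qed.

Lemma signZ (n : nat) (x : C) : (-1 : R) ^+ n *: x = (-1) ^+ n * x.
Proof.
rewrite -[in LHS]signr_odd -[in RHS]signr_odd.
by case: odd; rewrite /= ?expr0 ?expr1 ?scale1r ?mul1r // scaleN1r mulN1r.
Qed.

Definition inner_form a F s := F (a :: s).
Definition sgn_form F s : C := (-1) ^+ size s * F s.

Lemma inner_subproof a P : inner_form a P \in @multivector_pred R C L.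
Proof.
have [Pl Ps [m Pm]] := is_multivectorP P; apply: multivector_of; split.
- by move=> s; exact: (Pl (a :: s)).
- by move=> s; exact: (Ps (a :: s)).
by exists m => s ms; apply: Pm; apply: leqW.
Qed.
Definition inner a P : mv := Multivector (inner_subproof a P).

Lemma sgn_subproof P : sgn_form P \in @multivector_pred R C L.
Proof.
have [Pl Ps [m Pm]] := is_multivectorP P; apply: multivector_of; split.
- by move=> s t f a b; rewrite /sgn_form !size_cat /= Pl mulrDr mulrCA.
- by move=> s t a b; rewrite /sgn_form !size_cat /= Ps mulrN.
by exists m => s /Pm; rewrite /sgn_form => ->; rewrite mulr0.
Qed.
Definition sgn P : mv := Multivector (sgn_subproof P).

Section FormDerivation.
Variables (D : dual -> dual) (dl : C -> C).

(* The sum of the F(a_1, .., D a_i, .., a_n), plus dl (F(a_1, .., a_n)). *)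
Fixpoint der_form F s : C :=
  if s is a :: s' then F (D a :: s') + der_form (inner_form a F) s'
  else dl (F [::]).

Hypothesis dlD : forall (c : R) f g, dl (c *: f + g) = c *: dl f + dl g.
Hypothesis dlM : forall f g, dl (f * g) = dl f * g + f * dl g.
Hypothesis DD : forall (f : C) a b,
  D ((f \*: a) \+ b : dual) =
  ((f \*: D a) \+ ((- dl f) \*: a \+ D b : dual) : dual).

Lemma dl0 : dl 0 = 0.
Proof. by have := dlD (-1) 0 0; rewrite scaler0 addr0 scaleN1r addNr. Qed.

Lemma dl_add f g : dl (f + g) = dl f + dl g.
Proof. by have := dlD 1 f g; rewrite !scale1r. Qed.

Lemma der_form_linear (c : R) F G H s :
  (forall t, F t = c *: G t + H t) ->
  der_form F s = c *: der_form G s + der_form H s.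
Proof.
elim: s F G H => [|a s IH] F G H FE /=; first by rewrite FE dlD.
rewrite FE (IH _ (inner_form a G) (inner_form a H)); last by move=> t; apply: FE.
by rewrite scalerDr addrACA.
Qed.

Lemma der_form0 s : der_form (fun=> 0) s = 0.
Proof. by elim: s => [|a s IH] /=; rewrite ?dl0 // add0r. Qed.

Lemma der_form_sign (n : nat) F s :
  der_form (fun t => (-1) ^+ n * F t) s = (-1) ^+ n * der_form F s.
Proof.
rewrite (@der_form_linear ((-1) ^+ n) _ F (fun=> 0)) ?der_form0 ?addr0 ?signZ //.
by move=> t; rewrite addr0 signZ.
Qed.

Lemma eq_der_form F G s : F =1 G -> der_form F s = der_form G s.
Proof. by move=> FG; congr der_form; apply/funext. Qed.

Lemma der_form_sgn F s : der_form (sgn_form F) s = sgn_form (der_form F) s.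
Proof.
elim: s F => [|a s IH] F /=; first by rewrite /sgn_form /= !mul1r.
rewrite {1 3}/sgn_form /= mulrDr; congr (_ + _).
rewrite (@eq_der_form _ (fun t => (-1) ^+ 1 * sgn_form (inner_form a F) t)); last first.
  by move=> t; rewrite /inner_form /sgn_form /= exprS expr1 mulrA.
rewrite der_form_sign IH /sgn_form. by rewrite expr1 exprS mulrA.
Qed.

(** The term -dl f that [DD] produces in the slot of f a cancels the derivative of the coefficient f
    of F; this is why [DD] carries a minus sign. *)
Lemma der_form_lin F : mv_lin F -> mv_lin (der_form F).
Proof.
move=> Fl s; elim: s F Fl => [|c s IH] F Fl t f a b; rewrite /= ?cat0s ?cat_cons.
  rewrite DD.
  rewrite (Fl [::]) (Fl [::] t (- dl f)) /=.
  have -> : der_form (inner_form (f \*: a \+ b : dual) F) t =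
    dl f * F (a :: t) + f * der_form (inner_form a F) t + der_form (inner_form b F) t.
    have Fh u : inner_form (f \*: a \+ b : dual) F u =
      f * inner_form a F u + inner_form b F u by exact: (Fl [::]).
    rewrite -/(inner_form a F t).
    move: (inner_form _ F) (inner_form a F) (inner_form b F) Fh => Z A B.
    elim: t Z A B => [|d t IHt] Z A B ZE /=.
      by rewrite ZE dl_add dlM.
    rewrite ZE (IHt _ (inner_form d A) (inner_form d B)) /inner_form; last first.
      by move=> u; apply: ZE.
    by rewrite -/(inner_form d _) -/(inner_form d _); ring.
  by ring.
rewrite (Fl (D c :: s)) (IH (inner_form c F)); last first.
  by move=> u; exact: (Fl (c :: u)).
by rewrite /=; ring.
Qed.

Lemma der_form_skew F : mv_skew F -> mv_skew (der_form F).
Proof.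
move=> Fs s; elim: s F Fs => [|c s IH] F Fs t a b; rewrite /= ?cat0s ?cat_cons.
  have -> : der_form (inner_form b (inner_form a F)) t =
            - der_form (inner_form a (inner_form b F)) t.
    rewrite -[RHS]mulN1r -[-1]expr1 -der_form_sign; apply: eq_der_form.
    by move=> u; rewrite expr1 mulN1r; exact: (Fs [::]).
  have /= e1 := Fs [::] t (D a) b; have /= e2 := Fs [::] t a (D b).
  by rewrite /inner_form e1 e2; ring.
rewrite (Fs (D c :: s)) (IH (inner_form c F)); last first.
  by move=> u; exact: (Fs (c :: u)).
by rewrite /=; ring.
Qed.

(** An arbitrary predicate on lengths serves boundedness, parity and homogeneity at once. *)
Lemma der_form_degree (p : pred nat) F :
  (forall s, p (size s) -> F s = 0) -> forall s, p (size s) -> der_form F s = 0.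
Proof.
move=> F0 s; elim: s p F F0 => [|a s IH] p F F0 ps /=; first by rewrite F0 ?dl0.
rewrite F0 // (IH (fun n => p n.+1)) ?addr0 // => t pt; exact: F0.
Qed.

Lemma der_subproof P : der_form P \in @multivector_pred R C L.
Proof.
have [Pl Ps [m Pm]] := is_multivectorP P; apply: multivector_of; split.
- exact: der_form_lin.
- exact: der_form_skew.
exists m; exact: (@der_form_degree (fun n => m < n)%N).
Qed.

Lemma wedge_form_der F G s :
  der_form (wedge_form F G) s =
  wedge_form (der_form F) G s + wedge_form F (der_form G) s.
Proof.
elim: s F G => [|a s IH] F G; first by rewrite /= dlM.
rewrite /= (@der_form_linear 1 _ (wedge_form (inner_form a F) G)
    (wedge_form (sgn_form F) (inner_form a G))); last by move=> t; rewrite scale1r.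
rewrite scale1r !IH /=.
rewrite (@wedge_form_linl _ _ _ (fun t => F (D a :: t) + _ t) (inner_form (D a) F)
   (der_form (inner_form a F)) _ 1); last by move=> t; rewrite mul1r.
rewrite (@wedge_form_linr _ _ _ _ (fun t => G (D a :: t) + _ t) (inner_form (D a) G)
   (der_form (inner_form a G)) 1); last by move=> t; rewrite mul1r.
rewrite (_ : der_form (sgn_form F) = sgn_form (der_form F)); last first.
  by apply/funext => t; exact: der_form_sgn.
by rewrite /inner_form /sgn_form; ring.
Qed.

End FormDerivation.

End Multivectors.

(** * Derivations of the module of sections, extended to multivectors *)

Section ModuleDerivations.
Variables (R : realType) (C : comAlgType R) (L : lmodType C).
Local Notation dual := (dual L).
Local Notation form := (seq dual -> C).
Local Notation mv := (multivector L).
Implicit Types (F G H : form) (P Q T : mv) (a b : dual) (s t : seq dual).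

Definition mk_dual (u : L -> C) (u_lin : linear (u : L -> C^o)) : dual :=
  HB.pack_for {linear L -> C^o} (u : L -> C^o)
    (GRing.isLinear.Build C L C^o _ (u : L -> C^o) u_lin).

(** Common frame for the two derivations in use: a covariant derivative, with [md_fun] the anchor,
    and a (1,1)-tensor, with [md_fun] zero. *)
Record module_derivation : Type := ModuleDerivation {
  md_vec :> L -> L;
  md_fun : C -> C;
  md_linear : forall (c : R) f g, md_fun (c *: f + g) = c *: md_fun f + md_fun g;
  md_mul : forall f g, md_fun (f * g) = md_fun f * g + f * md_fun g;
  md_vec_leibniz : forall f X Y,
    md_vec (f *: X + Y) = f *: md_vec X + md_fun f *: X + md_vec Y }.

Implicit Types E : module_derivation.

Lemma md_add E f g : md_fun E (f + g) = md_fun E f + md_fun E g.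
Proof. exact: dl_add (md_linear E) _ _. Qed.

Lemma md_codual_linear E a :
  linear ((fun X => a (E X) - md_fun E (a X)) : L -> C^o).
Proof.
move=> f X Y /=; rewrite md_vec_leibniz !linearD !linearZ /= md_add md_mul.
by rewrite /GRing.scale /=; ring.
Qed.

(* Minus the dual derivation, so that it enters der_form with a plus sign; for E = N it is N^* a. *)
Definition md_codual E a : dual := mk_dual (md_codual_linear E a).

Lemma md_codualE E a X : md_codual E a X = a (E X) - md_fun E (a X).
Proof. by []. Qed.

Lemma md_codual_leibniz E (f : C) a b :
  md_codual E ((f \*: a) \+ b : dual) =
  ((f \*: md_codual E a) \+ ((- md_fun E f) \*: a \+ md_codual E b : dual) : dual).
Proof.
apply: dual_ext => X; rewrite /= md_add md_mul /GRing.scale /=; ring.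
Qed.

Definition mder E P : mv :=
  Multivector (der_subproof (md_linear E) (md_mul E) (md_codual_leibniz E) P).

Lemma mder_linear E (c : R) P Q : mder E (c *: P + Q) = c *: mder E P + mder E Q.
Proof.
by apply: mv_ext => s; rewrite /= (der_form_linear _ (md_linear E) (c := c) (G := P) (H := Q)).
Qed.

Lemma mder_wedge E P Q : mder E (wedge P Q) = wedge (mder E P) Q + wedge P (mder E Q).
Proof.
by apply: mv_ext => s; rewrite mvE /= (wedge_form_der _ (md_linear E) (md_mul E)).
Qed.

Lemma mder_fun E f : mder E (mv_fun L f) = mv_fun L (md_fun E f).
Proof.
apply: mv_ext => -[|a s] //=; rewrite add0r.
exact: (der_form0 _ (md_linear E)).
Qed.

Lemma mder_vec E X : mder E (mv_vec X) = mv_vec (E X).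
Proof.
apply: mv_ext => -[|a [|b s]] /=; rewrite ?(dl0 (md_linear E)) //.
  by rewrite /inner_form addrNK.
by rewrite /inner_form !add0r; exact: (der_form0 _ (md_linear E)).
Qed.

Lemma mder_degree E (p : pred nat) P :
  (forall s, p (size s) -> P s = 0) -> forall s, p (size s) -> mder E P s = 0.
Proof. by move=> P0 s; exact: (der_form_degree _ (md_linear E) P0). Qed.

End ModuleDerivations.

(** * The exterior algebra *)

Section WedgeAlgebra.
Variables (R : realType) (C : comAlgType R) (L : lmodType C).
Local Notation dual := (dual L).
Local Notation form := (seq dual -> C).
Local Notation mv := (multivector L).
Implicit Types (F G H : form) (P Q T : mv) (a : dual) (b c : bool) (s t : seq dual).

Lemma wedge_form_cons F G a s :
  wedge_form F G (a :: s) =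
  wedge_form (inner_form a F) G s + wedge_form (sgn_form F) (inner_form a G) s.
Proof. by []. Qed.

Lemma wedge_formDl F G H s :
  wedge_form (fun t => F t + G t) H s = wedge_form F H s + wedge_form G H s.
Proof. by rewrite (@wedge_form_linl _ _ _ _ F G H 1) ?mul1r // => t; rewrite mul1r. Qed.

Lemma wedge_formDr F G H s :
  wedge_form F (fun t => G t + H t) s = wedge_form F G s + wedge_form F H s.
Proof. by rewrite (@wedge_form_linr _ _ _ _ _ G H 1) ?mul1r // => t; rewrite mul1r. Qed.

Lemma wedge_formZl (f : C) F G s :
  wedge_form (fun t => f * F t) G s = f * wedge_form F G s.
Proof.
rewrite (@wedge_form_linl _ _ _ _ F (fun=> 0) G f) ?wedge_form0l ?addr0 // => t.
by rewrite addr0.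
Qed.

Lemma wedge_formZr (f : C) F G s :
  wedge_form F (fun t => f * G t) s = f * wedge_form F G s.
Proof.
rewrite (@wedge_form_linr _ _ _ _ _ G (fun=> 0) f) ?wedge_form0r ?addr0 // => t.
by rewrite addr0.
Qed.

Lemma inner_sgn a F : inner_form a (sgn_form F) = (fun s => -1 * sgn_form (inner_form a F) s).
Proof.
by apply/funext => s; rewrite /sgn_form /inner_form /= exprS; ring.
Qed.

Lemma sgn_wedge_form F G :
  sgn_form (wedge_form F G) = wedge_form (sgn_form F) (sgn_form G).
Proof.
apply/funext => s; elim: s F G => [|a s IH] F G; first by rewrite /sgn_form /= !mul1r.
rewrite wedge_form_cons !inner_sgn wedge_formZl wedge_formZr -!IH.
by rewrite /sgn_form -/(sgn_form _) wedge_form_cons exprS; ring.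
Qed.

Lemma wedge_formA F G H :
  wedge_form (wedge_form F G) H = wedge_form F (wedge_form G H).
Proof.
apply/funext => s; elim: s F G H => [|a s IH] F G H; first by rewrite /= mulrA.
rewrite !wedge_form_cons.
have inW A B : inner_form a (wedge_form A B) =
   (fun t => wedge_form (inner_form a A) B t + wedge_form (sgn_form A) (inner_form a B) t) by [].
by rewrite !inW wedge_formDl wedge_formDr sgn_wedge_form !IH addrA.
Qed.

(** Parity replaces degree: signs become powers of -1 with Boolean exponents, and case analysis
    followed by [ring] settles them. *)
Definition pure_form (b : bool) F := forall s, odd (size s) != b -> F s = 0.

Lemma pure_inner_form b a F : pure_form b F -> pure_form (~~ b) (inner_form a F).
Proof. by move=> Fb s sb; apply: Fb => /=; move: sb; case: odd; case: b. Qed.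

Lemma pure_sgn_form b F : pure_form b F -> sgn_form F = (fun s => (-1) ^+ b * F s).
Proof.
move=> Fb; apply/funext => s; rewrite /sgn_form.
have [<-|/Fb ->] := eqVneq (odd (size s)) b; last by rewrite !mulr0.
by rewrite signr_odd.
Qed.

Lemma wedge_formC b c F G s : pure_form b F -> pure_form c G ->
  wedge_form F G s = (-1) ^+ (b && c) * wedge_form G F s.
Proof.
elim: s b c F G => [|a s IH] b c F G Fb Gc.
  rewrite /=; case: b Fb => Fb; last by rewrite mul1r mulrC.
  by rewrite Fb // mul0r !mulr0.
rewrite !wedge_form_cons (pure_sgn_form Fb) (pure_sgn_form Gc) !wedge_formZl.
have Fa := pure_inner_form a Fb; have Ga := pure_inner_form a Gc.
rewrite (IH (~~ b) c (inner_form a F) G) // (IH b (~~ c) F (inner_form a G)) //.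
by case: b c {Fb Gc Fa Ga} => -[]; rewrite /= ?expr0 ?expr1; ring.
Qed.

Lemma pure_wedge_form b c F G :
  pure_form b F -> pure_form c G -> pure_form (b (+) c) (wedge_form F G).
Proof.
move=> Fb Gc s; elim: s b c F G Fb Gc => [|a s IH] b c F G Fb Gc sE.
  rewrite /=; case: b Fb sE => Fb; first by rewrite Fb // mul0r.
  by case: c Gc => // Gc _; rewrite Gc // mulr0.
have Fa := pure_inner_form a Fb; have Ga := pure_inner_form a Gc.
rewrite wedge_form_cons (IH (~~ b) c) ?(pure_sgn_form Fb) ?wedge_formZl //; last first.
  by move: sE => /=; case: odd; case: b {Fb Fa}; case: c {Gc Ga}.
rewrite (IH b (~~ c)) ?mulr0 ?addr0 //.
by move: sE => /=; case: odd; case: b {Fb Fa}; case: c {Gc Ga}.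
Qed.

Lemma wedge_fun_form f G s : wedge_form (mv_fun L f) G s = f * G s.
Proof.
elim: s G => [|a s IH] G //; rewrite wedge_form_cons.
rewrite (_ : inner_form a (mv_fun L f) = (fun=> 0)) // wedge_form0l add0r.
rewrite (_ : sgn_form (mv_fun L f) = mv_fun L f) ?IH //.
by apply/funext => -[|c t]; rewrite /sgn_form /= ?mul1r // mulr0.
Qed.

Lemma wedge_form_fun f F s : wedge_form F (mv_fun L f) s = f * F s.
Proof.
elim: s F => [|a s IH] F; first by rewrite /= mulrC.
rewrite wedge_form_cons (_ : inner_form a (mv_fun L f) = (fun=> 0)) //.
by rewrite wedge_form0r addr0 IH.
Qed.

Lemma wedgeDl P Q T : wedge (P + Q) T = wedge P T + wedge Q T.
Proof. by apply: mv_ext => s; exact: wedge_formDl. Qed.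

Lemma wedgeDr P Q T : wedge T (P + Q) = wedge T P + wedge T Q.
Proof. by apply: mv_ext => s; exact: wedge_formDr. Qed.

Lemma wedge0l P : wedge 0 P = 0.
Proof. by apply: mv_ext => s; exact: wedge_form0l. Qed.

Lemma wedge0r P : wedge P 0 = 0.
Proof. by apply: mv_ext => s; exact: wedge_form0r. Qed.

Lemma wedgeZl (c : R) P Q : wedge (c *: P) Q = c *: wedge P Q.
Proof.
apply: mv_ext => s; rewrite mvE /=.
rewrite -[in RHS](mul1r (wedge_form _ _ _)) scalerAl -wedge_formZl.
by congr wedge_form; apply/funext => t; rewrite -scalerAl mul1r.
Qed.

Lemma wedgeZr (c : R) P Q : wedge P (c *: Q) = c *: wedge P Q.
Proof.
apply: mv_ext => s; rewrite mvE /=.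
rewrite -[in RHS](mul1r (wedge_form _ _ _)) scalerAl -wedge_formZr.
by congr wedge_form; apply/funext => t; rewrite -scalerAl mul1r.
Qed.

Lemma wedgeNl P Q : wedge (- P) Q = - wedge P Q.
Proof. by rewrite -scaleN1r wedgeZl scaleN1r. Qed.

Lemma wedgeNr P Q : wedge P (- Q) = - wedge P Q.
Proof. by rewrite -scaleN1r wedgeZr scaleN1r. Qed.

Lemma wedgeA P Q T : wedge P (wedge Q T) = wedge (wedge P Q) T.
Proof. by apply: mv_ext => s; rewrite /= wedge_formA. Qed.

Definition pure (b : bool) P := pure_form b P.

Lemma wedgeC b c P Q : pure b P -> pure c Q ->
  wedge P Q = (-1) ^+ (b && c) *: wedge Q P.
Proof. by move=> Pb Qc; apply: mv_ext => s; rewrite mvE signZ; exact: wedge_formC. Qed.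

Lemma pure_wedge b c P Q : pure b P -> pure c Q -> pure (b (+) c) (wedge P Q).
Proof. exact: pure_wedge_form. Qed.

Lemma sgn_pure b P : pure b P -> sgn P = (-1) ^+ b *: P.
Proof.
by move=> Pb; apply: mv_ext => s; rewrite mvE signZ /= (pure_sgn_form Pb).
Qed.

Lemma pure_inner b a P : pure b P -> pure (~~ b) (inner a P).
Proof. exact: pure_inner_form. Qed.

Lemma pure_sgn b P : pure b P -> pure b (sgn P).
Proof. by move=> Pb s sb; rewrite /= /sgn_form Pb // mulr0. Qed.

Lemma pure_mder E b P : pure b P -> pure b (mder E P).
Proof. by move=> Pb; apply: (@mder_degree _ _ _ E (fun n => odd n != b)). Qed.

Lemma inner_wedge a P Q :
  inner a (wedge P Q) = wedge (inner a P) Q + wedge (sgn P) (inner a Q).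
Proof. exact: mv_ext. Qed.

Lemma wedge_fun f P s : wedge (mv_fun L f) P s = f * P s.
Proof. exact: wedge_fun_form. Qed.

Lemma wedge_funr f P s : wedge P (mv_fun L f) s = f * P s.
Proof. exact: wedge_form_fun. Qed.

Lemma pureD b P Q : pure b P -> pure b Q -> pure b (P + Q).
Proof. by move=> Pb Qb s sb; rewrite mvE Pb // Qb // addr0. Qed.

Lemma pureZ b (c : R) P : pure b P -> pure b (c *: P).
Proof. by move=> Pb s sb; rewrite mvE Pb // scaler0. Qed.

Lemma pureN b P : pure b P -> pure b (- P).
Proof. by move=> Pb s sb; rewrite mvE Pb // oppr0. Qed.

Lemma pure0 b : pure b 0. Proof. by []. Qed.

Lemma pure_fun f : pure false (mv_fun L f).
Proof. by case. Qed.

Lemma pure_vec X : pure true (mv_vec X).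
Proof. by case=> [|a [|b s]]. Qed.

Lemma homogeneous_pure p P : homogeneous p P -> pure (odd p) P.
Proof. by move=> hP s sp; apply: hP; apply: contraNN sp => /eqP ->. Qed.

End WedgeAlgebra.

(** * Dual bases and generation by sections *)

Section DualBasis.
Variables (R : realType) (C : comAlgType R) (L : lmodType C).
Local Notation dual := (dual L).
Local Notation form := (seq dual -> C).
Local Notation mv := (multivector L).
Implicit Types (X Y : L) (f g : C).
Implicit Types (F G H : form) (P Q T : mv) (a b : dual) (s t : seq dual).

Definition is_dual_basis n (e : 'I_n -> L) (ep : 'I_n -> dual) : Prop :=
  forall X, X = \sum_j ep j X *: e j.

Lemma dual_basis_exists : fg_projective L ->
  exists n (e : 'I_n -> L) (ep : 'I_n -> dual), is_dual_basis e ep.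
Proof.
move=> [n [i [p ipK]]].
have ep_lin j : linear ((fun X => i X 0 j) : L -> C^o).
  by move=> f X Y /=; rewrite linearD linearZ !mxE.
exists n, (fun j => p (delta_mx 0 j)), (fun j => mk_dual (ep_lin j)) => X.
rewrite -[LHS]ipK {1}[i X]row_sum_delta linear_sum /=.
by apply: eq_bigr => j _; rewrite linearZ.
Qed.

Lemma mv_cons0 P t (z : dual) : (forall X, z X = 0) -> P (z :: t) = 0.
Proof.
move=> z0; have := mv_linP P [::] t (-1) z z.
rewrite [(_ \+ _ : dual)](_ : _ = z); first by rewrite /= mulN1r addNr.
by apply: dual_ext => X; rewrite /= z0 /GRing.scale /= mulr0 addr0.
Qed.

Section Basis.
Variables (n : nat) (e : 'I_n -> L) (ep : 'I_n -> dual).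
Hypothesis eK : is_dual_basis e ep.

Lemma dual_expand P a t : P (a :: t) = \sum_j a (e j) * P (ep j :: t).
Proof.
have z_lin : linear ((fun=> 0) : L -> C^o) by move=> f X Y; rewrite scaler0 addr0.
(* The expansion of [a] is folded into the shape f a + b in which linearity of multivectors is
   stated. *)
pose comb r := foldr (fun j b => (a (e j) \*: ep j) \+ b : dual) (mk_dual z_lin) r.
have combE r X : comb r X = \sum_(j <- r) a (e j) * ep j X.
  by elim: r => [|j r IH]; rewrite ?big_nil // big_cons -IH.
rewrite {1}(_ : a = comb (index_enum 'I_n)); last first.
  apply: dual_ext => X; rewrite combE {1}[X]eK linear_sum /=.
  by apply: eq_bigr => j _; rewrite linearZ /= mulrC.
elim: (index_enum _) => [|j r IH]; first by rewrite big_nil mv_cons0.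
by rewrite big_cons -IH; exact: (mv_linP P [::]).
Qed.

(* Dividing by the degree, multivectors are sums of wedges of sections. *)
Lemma euler_form P s :
  \sum_j wedge (mv_vec (e j)) (inner (ep j) P) s = (size s)%:R * P s.
Proof.
elim: s P => [|a s IH] P.
  by rewrite mul0r big1 // => j _; rewrite /= mul0r.
transitivity (\sum_j (a (e j) * P (ep j :: s)
    + wedge (mv_vec (e j)) (inner (ep j) (inner a P)) s)).
  apply: eq_bigr => j _.
  have -> : wedge (mv_vec (e j)) (inner (ep j) P) (a :: s) =
    inner a (wedge (mv_vec (e j)) (inner (ep j) P)) s by [].
  rewrite inner_wedge (sgn_pure (pure_vec _)) wedgeZl expr1 scaleN1r !mvD mvN.
  congr (_ + _).
    by rewrite -[RHS](wedge_fun _ (inner (ep j) P)); congr (wedge _ _ s); apply: mv_ext => -[].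
  rewrite -mvN -wedgeNr; congr (wedge _ _ s); apply: mv_ext => t.
  by rewrite mvN; apply/eqP; rewrite eqr_oppLR; apply/eqP; exact: (mv_skewP P [::]).
rewrite big_split /= -dual_expand; have /= -> := IH (inner a P).
by rewrite -natr1 mulrDl mul1r addrC.
Qed.

End Basis.

Lemma hom_part_subproof p P :
  (fun s => if size s == p then P s else 0) \in @multivector_pred R C L.
Proof.
have [Pl Ps [m Pm]] := is_multivectorP P; apply: multivector_of; split.
- move=> s t f a b; rewrite !size_cat /= Pl; case: ifP => // _.
  by rewrite mulr0 addr0.
- by move=> s t a b; rewrite !size_cat /= Ps; case: ifP => // _; rewrite oppr0.
by exists m => s /Pm ->; rewrite if_same.
Qed.

Definition hom_part p P : mv := Multivector (hom_part_subproof p P).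

Lemma hom_part_homogeneous p P : homogeneous p (hom_part p P).
Proof. by move=> s /negPf /= ->. Qed.

Lemma hom_part_sum P : exists m, P = \sum_(p < m) hom_part p P.
Proof.
have [_ _ [m Pm]] := is_multivectorP P; exists m.+1; apply: mv_ext => s.
rewrite mvsum; case: (ltnP (size s) m.+1) => sm; last first.
  by rewrite Pm // big1 // => p _ /=; rewrite Pm // if_same.
rewrite (bigD1 (Ordinal sm)) //= eqxx big1 ?addr0 // => p.
by rewrite -val_eqE /= eq_sym => /negPf ->.
Qed.

(** [euler_form] divided by p + 1 writes P as a combination of wedges of the [e j] with contractions
    of P, which have degree p. *)
Lemma homogeneous_ind (Phi : nat -> mv -> Prop) : fg_projective L ->
  (forall p, Phi p 0) ->
  (forall p (c : R) P Q, Phi p P -> Phi p Q -> Phi p (c *: P + Q)) ->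
  (forall f, Phi 0%N (mv_fun L f)) ->
  (forall p X P, Phi p P -> Phi p.+1 (wedge (mv_vec X) P)) ->
  forall p P, homogeneous p P -> Phi p P.
Proof.
move=> /dual_basis_exists[n [e [ep eK]]] Phi0 PhiD Phif PhiX.
elim=> [|p IH] P hP.
  suff -> : P = mv_fun L (P [::]) by apply: Phif.
  by apply: mv_ext => -[|a s] //=; rewrite hP.
have -> : P = p.+1%:R^-1 *: (\sum_j wedge (mv_vec (e j)) (inner (ep j) P)).
  apply: mv_ext => s; rewrite mvE mvsum (euler_form eK).
  have [->|/hP ->] := eqVneq (size s) p.+1; last by rewrite mulr0 scaler0.
  rewrite mulr_natl -scaler_nat scalerA mulVf ?scale1r //.
  by rewrite pnatr_eq0.
rewrite -[_ *: _]addr0; apply: (PhiD _); last exact: Phi0.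
elim/big_ind: _ => [|P1 P2 h1 h2|j _]; first exact: Phi0.
  by rewrite -[P1]scale1r; apply: PhiD.
by apply/PhiX/IH => s sp; apply: hP.
Qed.

Lemma mv_ind (Phi : mv -> Prop) : fg_projective L -> Phi 0 ->
  (forall (c : R) P Q, Phi P -> Phi Q -> Phi (c *: P + Q)) ->
  (forall f, Phi (mv_fun L f)) ->
  (forall X P, Phi P -> Phi (wedge (mv_vec X) P)) -> forall P, Phi P.
Proof.
move=> hL Phi0 PhiD Phif PhiX P; have [m ->] := hom_part_sum P.
elim/big_ind: _ => [|P1 P2 h1 h2|p _] //.
  by rewrite -[P1]scale1r; apply: PhiD.
apply: (homogeneous_ind (Phi := fun=> Phi) hL) => //.
exact: (@hom_part_homogeneous p P).
Qed.

Lemma linear_map0 (V W : lmodType R) (A : V -> W) :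
  (forall (c : R) (P Q : V), A (c *: P + Q) = c *: A P + A Q) -> A 0 = 0.
Proof. by move=> Al; have := Al (-1) 0 0; rewrite scaler0 addr0 scaleN1r addNr. Qed.

Lemma homogeneous_vec X : homogeneous 1 (mv_vec X).
Proof. by case=> [|a [|b s]]. Qed.

Lemma homogeneous_fun f : homogeneous 0 (mv_fun L f).
Proof. by case. Qed.

(** The Leibniz rule acts in the second argument only. With a generator in first place the second is
    extended; skewness then gives the values of an arbitrary homogeneous first argument on
    generators, and the second is extended again. *)
Lemma schouten_unique br rho (S1 S2 : mv -> mv -> mv) : fg_projective L ->
  is_schouten br rho S1 -> is_schouten br rho S2 -> forall P Q, S1 P Q = S2 P Q.
Proof.
move=> hL hS1 hS2.
have lin0 S T : is_schouten br rho S -> S T 0 = 0.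
  by move=> hS; apply: (linear_map0 (A := S T)) => c P Q; rewrite (sn_linearr hS).
have ext p P : homogeneous p P -> (forall f, S1 P (mv_fun L f) = S2 P (mv_fun L f)) ->
    (forall X, S1 P (mv_vec X) = S2 P (mv_vec X)) -> forall Q, S1 P Q = S2 P Q.
  move=> hP Pf PX; apply: mv_ind => //.
  - by rewrite !lin0.
  - by move=> c Q T eQ eT; rewrite (sn_linearr hS1) (sn_linearr hS2) eQ eT.
  move=> X Q eQ; have hX := homogeneous_vec X.
  by rewrite (sn_leibniz hS1 _ hP hX) (sn_leibniz hS2 _ hP hX) PX eQ.
have extf f : forall Q, S1 (mv_fun L f) Q = S2 (mv_fun L f) Q.
  have hf := homogeneous_fun f; apply: (ext 0%N) => // [g|X].
    by rewrite (sn_fun_fun hS1) (sn_fun_fun hS2).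
  have hX := homogeneous_vec X.
  by rewrite (sn_skew hS1 hf hX) (sn_skew hS2 hf hX) (sn_vec_fun hS1) (sn_vec_fun hS2).
have extX X : forall Q, S1 (mv_vec X) Q = S2 (mv_vec X) Q.
  have hX := homogeneous_vec X; apply: (ext 1%N) => // [f|Y].
    by rewrite (sn_vec_fun hS1) (sn_vec_fun hS2).
  by rewrite (sn_vec_vec hS1) (sn_vec_vec hS2).
have exth p P : homogeneous p P -> forall Q, S1 P Q = S2 P Q.
  move=> hP; apply: (ext p) => // [f|X].
    have hf := homogeneous_fun f.
    by rewrite (sn_skew hS1 hP hf) (sn_skew hS2 hP hf) extf.
  have hX := homogeneous_vec X.
  by rewrite (sn_skew hS1 hP hX) (sn_skew hS2 hP hX) extX.
move=> P Q; have [m ->] := hom_part_sum P.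
elim/big_ind: _ => [|P1 P2 h1 h2|p _]; last first.
- exact: exth (@hom_part_homogeneous p P) Q.
- rewrite -[P1]scale1r (sn_linearl hS1) (sn_linearl hS2).
  by rewrite h1 h2.
by apply: (exth 0%N).
Qed.

Section LinearMap.
Variable N : {linear L -> L}.

Lemma lin_md_leibniz f X Y : N (f *: X + Y) = f *: N X + 0 *: X + N Y.
Proof. by rewrite linearD linearZ scale0r addr0. Qed.

Definition lin_md : module_derivation L :=
  @ModuleDerivation R C L N (fun=> 0)
    (fun (c : R) (_ _ : C) => esym (etrans (addr0 (c *: 0)) (scaler0 C c)))
    (fun f g : C => esym (etrans (congr2 +%R (mul0r g) (mulr0 f)) (addr0 0)))
    lin_md_leibniz.

Lemma lin_md_extension : is_derivation_extension N (mder lin_md).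
Proof.
split=> [c P Q|f|Xs].
- exact: mder_linear.
- by rewrite mder_fun; apply: mv_ext => -[].
elim: Xs => [|X Xs IH] /=.
  by rewrite big_ord0 mder_fun; apply: mv_ext => -[].
rewrite mder_wedge mder_vec IH big_ord_recl /=; congr (_ + _).
by apply: (big_morph (wedge (mv_vec X))) => [P Q|]; rewrite ?wedgeDr ?wedge0r.
Qed.

(** [is_derivation_extension] prescribes values on functions and on wedges of sections, with no
    Leibniz rule, so uniqueness requires these to span everything over the reals. A function factor
    is absorbed into a section. *)
Inductive vec_span : mv -> Prop :=
| Span_fun f : vec_span (mv_fun L f)
| Span_vecs Xs : vec_span (wedge_vecs Xs)
| Span_comb (c : R) P Q : vec_span P -> vec_span Q -> vec_span (c *: P + Q).

Lemma wedge_vec_span X P : vec_span P -> vec_span (wedge (mv_vec X) P).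
Proof.
elim=> [f|Xs|c P1 P2 _ h1 _ h2]; last by rewrite wedgeDr wedgeZr; exact: Span_comb.
  rewrite (_ : wedge _ _ = wedge_vecs [:: f *: X]); first exact: Span_vecs.
  rewrite /= (wedgeC (@pure_vec _ _ _ X) (@pure_fun _ _ _ f)) expr0 scale1r.
  rewrite (wedgeC (@pure_vec _ _ _ _) (@pure_fun _ _ _ 1)) expr0 scale1r.
  apply: mv_ext => s; rewrite !wedge_fun mul1r.
  by case: s => [|a [|b s]] /=; rewrite ?mulr0 // linearZ.
exact: (Span_vecs (X :: Xs)).
Qed.

Lemma derivation_extensionE : fg_projective L ->
  derivation_extension N = mder lin_md.
Proof.
move=> hL.
have hD : is_derivation_extension N (derivation_extension N).
  apply: (@xgetPex _ _ [set D | is_derivation_extension N D]).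
  by exists (mder lin_md); exact: lin_md_extension.
apply/funext => P; have hM := lin_md_extension.
have: vec_span P.
  apply: (mv_ind hL).
  - rewrite (_ : 0 = mv_fun L 0); first exact: Span_fun.
    by apply: mv_ext => -[].
  - exact: Span_comb.
  - exact: Span_fun.
  exact: wedge_vec_span.
elim=> [f|Xs|c P1 P2 _ h1 _ h2].
- by rewrite (de_fun hD) (de_fun hM).
- by rewrite (de_wedge hD) (de_wedge hM).
by rewrite (de_linear hD) (de_linear hM) h1 h2.
Qed.

End LinearMap.
End DualBasis.

(** * Existence of the Schouten bracket *)

Section Connection.
Variables (R : realType) (C : comAlgType R) (L : lmodType C).
Local Notation dual := (dual L).
Local Notation mv := (multivector L).
Implicit Types (X Y Z : L) (f g : C).
Implicit Types (P Q T : mv) (a : dual) (b c : bool) (s t : seq dual).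
Variables (br : L -> L -> L) (rho : L -> C -> C).
Hypothesis pla : pre_lie_algebroid br rho.

Lemma anchorD X f g : rho X (f + g) = rho X f + rho X g.
Proof. by have := pla_rho_scalar pla X 1 f g; rewrite !scale1r. Qed.

Lemma anchor0 X : rho X 0 = 0.
Proof. by have := pla_rho_scalar pla X (-1) 0 0; rewrite scaler0 addr0 scaleN1r addNr. Qed.

Lemma anchorN X f : rho X (- f) = - rho X f.
Proof. by have := pla_rho_scalar pla X (-1) f 0; rewrite addr0 anchor0 addr0 !scaleN1r. Qed.

Lemma anchor_vec0 f : rho 0 f = 0.
Proof. by have := pla_rho_linear pla (-1) 0 0 f; rewrite scaler0 addr0 mulN1r addNr. Qed.

Lemma anchor_vecD X Y f : rho (X + Y) f = rho X f + rho Y f.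
Proof. by have := pla_rho_linear pla 1 X Y f; rewrite scale1r mul1r. Qed.

Lemma anchor_vecZ X f g : rho (f *: X) g = f * rho X g.
Proof. by have := pla_rho_linear pla f X 0 g; rewrite anchor_vec0 !addr0. Qed.

Lemma anchor_vecN X f : rho (- X) f = - rho X f.
Proof. by rewrite -scaleN1r anchor_vecZ mulN1r. Qed.

Lemma br_addl X Y Z : br (X + Y) Z = br X Z + br Y Z.
Proof. by have := pla_br_linear pla 1 X Y Z; rewrite !scale1r. Qed.

Lemma br_addr X Y Z : br X (Y + Z) = br X Y + br X Z.
Proof. by rewrite (pla_br_skew pla) br_addl opprD -!(pla_br_skew pla X). Qed.

Lemma br_scalel X Y f : br (f *: X) Y = f *: br X Y - rho Y f *: X.
Proof. by rewrite (pla_br_skew pla) (pla_leibniz pla) opprD -scalerN -(pla_br_skew pla). Qed.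

Lemma br_oppr X Y : br X (- Y) = - br X Y.
Proof.
have br0 : br X 0 = 0 by apply: (addrI (br X 0)); rewrite -br_addr !addr0.
by apply/eqP; rewrite -addr_eq0 -br_addr addNr br0.
Qed.

Lemma br_oppl X Y : br (- X) Y = - br X Y.
Proof. by rewrite (pla_br_skew pla) br_oppr (pla_br_skew pla Y) opprK. Qed.

Section Basis.
Variables (n : nat) (e : 'I_n -> L) (ep : 'I_n -> dual).
Hypothesis eK : is_dual_basis e ep.

Lemma vec_ext X Y : (forall a, a X = a Y) -> X = Y.
Proof. by move=> XY; rewrite [X]eK [Y]eK; apply: eq_bigr => j _; rewrite XY. Qed.

(** The connection induced on a direct summand by the trivial connection of the free module:
    coordinates are differentiated along the anchor. *)
Definition naive_cov X Y : L := \sum_j rho X (ep j Y) *: e j.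

Lemma naive_cov_leibniz X f Y Z :
  naive_cov X (f *: Y + Z) = f *: naive_cov X Y + rho X f *: Y + naive_cov X Z.
Proof.
have -> : rho X f *: Y = \sum_j (rho X f * ep j Y) *: e j.
  by rewrite {1}[Y]eK scaler_sumr; apply: eq_bigr => j _; rewrite scalerA.
rewrite /naive_cov scaler_sumr -!big_split /=; apply: eq_bigr => j _.
rewrite linearD linearZ /= anchorD (pla_rho_derivation pla) !scalerDl !scalerA.
by rewrite [X in X + _]addrC.
Qed.

Lemma naive_cov_linear X f Y Z :
  naive_cov (f *: Y + Z) X = f *: naive_cov Y X + naive_cov Z X.
Proof.
rewrite /naive_cov scaler_sumr -big_split /=; apply: eq_bigr => j _.
by rewrite (pla_rho_linear pla) scalerDl scalerA.
Qed.

Let h : C := (2^-1 : R)%:A.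
Let hh : 2 * h = 1.
Proof. by rewrite /h mulr_natl -scaler_nat scalerA mulfV ?scale1r ?pnatr_eq0. Qed.

(* The average removes the torsion of naive_cov while keeping the Leibniz rules. *)
Definition cov_vec X Y : L := h *: (naive_cov X Y + naive_cov Y X + br X Y).

Lemma cov_leibniz X f Y Z :
  cov_vec X (f *: Y + Z) = f *: cov_vec X Y + rho X f *: Y + cov_vec X Z.
Proof.
apply: vec_ext => a.
rewrite /cov_vec naive_cov_leibniz naive_cov_linear br_addr (pla_leibniz pla).
rewrite !(linearD, linearZ) /= /GRing.scale /=.
(* The derivative of f occurs twice in the average, from [naive_cov] and from [br]; [hh] adds up the
   two halves. *)
rewrite -[X in _ = _ + X + _]mul1r -hh.
by ring.
Qed.

Lemma cov_linear X f Y Z :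
  cov_vec (f *: Y + Z) X = f *: cov_vec Y X + cov_vec Z X.
Proof.
apply: vec_ext => a.
rewrite /cov_vec naive_cov_leibniz naive_cov_linear br_addl br_scalel.
rewrite !(linearD, linearZ, linearN) /= !linearZ /= /GRing.scale /=.
by ring.
Qed.

Lemma cov_torsion X Y : cov_vec X Y - cov_vec Y X = br X Y.
Proof.
apply: vec_ext => a.
rewrite /cov_vec (pla_br_skew pla Y X).
rewrite !(linearD, linearZ, linearN) /= !(linearD, linearZ, linearN) /= /GRing.scale /=.
by rewrite -[RHS]mul1r -hh; ring.
Qed.

Definition cov X : module_derivation L :=
  ModuleDerivation (pla_rho_scalar pla X) (pla_rho_derivation pla X) (cov_leibniz X).

(* With a torsion-free connection nabla and dual bases (e_j), (ep_j),
   [P, Q] = \sum_j (right contraction of P by ep_j) /\ nabla_(e_j) Q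
                   - nabla_(e_j) P /\ (left contraction of Q by ep_j). *)
Definition schouten_term j P Q : mv :=
  wedge (sgn (inner (ep j) P)) (mder (cov (e j)) Q)
  - wedge (mder (cov (e j)) P) (inner (ep j) Q).

Definition cov_schouten P Q : mv := \sum_j schouten_term j P Q.

Lemma schouten_term_skew j b c P Q : pure b P -> pure c Q ->
  schouten_term j P Q = - ((-1) ^+ (~~ b && ~~ c) *: schouten_term j Q P).
Proof.
move=> Pb Qc; rewrite /schouten_term.
have iP := pure_inner (ep j) Pb; have iQ := pure_inner (ep j) Qc.
have dP := pure_mder (cov (e j)) Pb; have dQ := pure_mder (cov (e j)) Qc.
rewrite (sgn_pure iP) (sgn_pure iQ) !wedgeZl (wedgeC iP dQ) (wedgeC iQ dP).
case: b c {Pb Qc iP iQ dP dQ} => -[]; rewrite /= ?expr0 ?expr1 ?scale1r ?scaleN1r;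
  apply: mv_ext => s; rewrite !mvE; ring.
Qed.

Lemma schouten_term_leibniz j b c P Q T : pure b P -> pure c Q ->
  schouten_term j P (wedge Q T) =
  wedge (schouten_term j P Q) T + (-1) ^+ (~~ b && c) *: wedge Q (schouten_term j P T).
Proof.
move=> Pb Qc; rewrite /schouten_term.
have dP := pure_mder (cov (e j)) Pb; have iP := pure_sgn (pure_inner (ep j) Pb).
rewrite mder_wedge inner_wedge !(wedgeDl, wedgeDr, wedgeNl, wedgeNr) !wedgeA.
rewrite (sgn_pure Qc) wedgeZr wedgeZl (wedgeC iP Qc) (wedgeC dP Qc) !wedgeZl.
case: b c {Pb Qc dP iP} => -[]; rewrite /= ?expr0 ?expr1 ?scale1r ?scaleN1r;
  apply: mv_ext => s; rewrite !mvE; ring.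
Qed.

Lemma cov_schouten_skew b c P Q : pure b P -> pure c Q ->
  cov_schouten P Q = - ((-1) ^+ (~~ b && ~~ c) *: cov_schouten Q P).
Proof.
move=> Pb Qc; rewrite /cov_schouten scaler_sumr -sumrN; apply: eq_bigr => j _.
exact: schouten_term_skew.
Qed.

Lemma wedge_suml (I : Type) (r : seq I) (A : I -> mv) T :
  wedge (\sum_(i <- r) A i) T = \sum_(i <- r) wedge (A i) T.
Proof.
by apply: (big_morph (fun P => wedge P T)) => [P Q|]; rewrite ?wedgeDl ?wedge0l.
Qed.

Lemma wedge_sumr (I : Type) (r : seq I) (A : I -> mv) T :
  wedge T (\sum_(i <- r) A i) = \sum_(i <- r) wedge T (A i).
Proof.
by apply: (big_morph (wedge T)) => [P Q|]; rewrite ?wedgeDr ?wedge0r.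
Qed.

Lemma cov_schouten_leibniz b c P Q T : pure b P -> pure c Q ->
  cov_schouten P (wedge Q T) =
  wedge (cov_schouten P Q) T + (-1) ^+ (~~ b && c) *: wedge Q (cov_schouten P T).
Proof.
move=> Pb Qc; rewrite /cov_schouten wedge_suml wedge_sumr scaler_sumr -big_split /=.
by apply: eq_bigr => j _; exact: schouten_term_leibniz.
Qed.

Lemma inner_linear a (k : R) P Q : inner a (k *: P + Q) = k *: inner a P + inner a Q.
Proof. exact: mv_ext. Qed.

Lemma sgn_linear (k : R) P Q : sgn (k *: P + Q) = k *: sgn P + sgn Q.
Proof.
by apply: mv_ext => s; rewrite mvD mvZ /= /sgn_form scalerAr -mulrDr.
Qed.

Lemma sgn0 : sgn (0 : mv) = 0.
Proof. by apply: mv_ext => s; rewrite /= /sgn_form mulr0. Qed.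

Lemma cov_schouten_linearl (k : R) P Q T :
  cov_schouten (k *: P + Q) T = k *: cov_schouten P T + cov_schouten Q T.
Proof.
rewrite /cov_schouten scaler_sumr -big_split /=; apply: eq_bigr => j _.
rewrite /schouten_term inner_linear sgn_linear mder_linear !wedgeDl !wedgeZl.
by rewrite scalerDr scalerN opprD addrACA.
Qed.

Lemma cov_schouten_linearr (k : R) P Q T :
  cov_schouten T (k *: P + Q) = k *: cov_schouten T P + cov_schouten T Q.
Proof.
rewrite /cov_schouten scaler_sumr -big_split /=; apply: eq_bigr => j _.
rewrite /schouten_term inner_linear mder_linear !wedgeDr !wedgeZr.
by rewrite scalerDr scalerN opprD addrACA.
Qed.

Lemma anchor_sum (r : seq 'I_n) (k : 'I_n -> C) (E : 'I_n -> L) f :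
  rho (\sum_(j <- r) k j *: E j) f = \sum_(j <- r) k j * rho (E j) f.
Proof.
elim: r => [|j r IH]; first by rewrite !big_nil anchor_vec0.
by rewrite !big_cons (pla_rho_linear pla) IH.
Qed.

Lemma cov_sum (r : seq 'I_n) (k : 'I_n -> C) (E : 'I_n -> L) X :
  cov_vec (\sum_(j <- r) k j *: E j) X = \sum_(j <- r) k j *: cov_vec (E j) X.
Proof.
elim: r => [|j r IH]; last by rewrite !big_cons cov_linear IH.
rewrite !big_nil; have := cov_linear X (-1) 0 0.
by rewrite scaler0 addr0 scaleN1r addNr.
Qed.

Lemma sgn_fun f : sgn (mv_fun L f) = mv_fun L f.
Proof. by rewrite (sgn_pure (@pure_fun _ _ _ f)) expr0 scale1r. Qed.

Lemma inner_fun a f : inner a (mv_fun L f) = 0.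
Proof. by apply: mv_ext => s. Qed.

Lemma inner_vec a X : inner a (mv_vec X) = mv_fun L (a X).
Proof. by apply: mv_ext => -[]. Qed.

Lemma wedge_fun_fun f g : wedge (mv_fun L f) (mv_fun L g) = mv_fun L (f * g).
Proof. by apply: mv_ext => s; rewrite wedge_fun; case: s => //= *; rewrite mulr0. Qed.

Lemma wedge_fun_vec f X : wedge (mv_fun L f) (mv_vec X) = mv_vec (f *: X).
Proof.
by apply: mv_ext => s; rewrite wedge_fun; case: s => [|a [|a' s]] /=; rewrite ?mulr0 ?linearZ.
Qed.

Lemma wedge_vec_fun f X : wedge (mv_vec X) (mv_fun L f) = mv_vec (f *: X).
Proof.
by rewrite (wedgeC (@pure_vec _ _ _ X) (@pure_fun _ _ _ f)) expr0 scale1r wedge_fun_vec.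
Qed.

Lemma mv_fun_sum (r : seq 'I_n) (k : 'I_n -> C) :
  \sum_(j <- r) mv_fun L (k j) = mv_fun L (\sum_(j <- r) k j).
Proof.
apply: mv_ext => s; rewrite mvE; case: s => //= *; exact: big1.
Qed.

Lemma mv_vec_sum (r : seq 'I_n) (k : 'I_n -> L) :
  \sum_(j <- r) mv_vec (k j) = mv_vec (\sum_(j <- r) k j).
Proof.
apply: mv_ext => s; rewrite mvE; case: s => [|a [|a' s]] /=; try exact: big1.
by rewrite linear_sum.
Qed.

Lemma cov_schouten_vec_fun X f : cov_schouten (mv_vec X) (mv_fun L f) = mv_fun L (rho X f).
Proof.
rewrite {2}[X]eK anchor_sum -mv_fun_sum; apply: eq_bigr => j _.
by rewrite /schouten_term inner_vec inner_fun wedge0r subr0 sgn_fun mder_fun wedge_fun_fun.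
Qed.

(** Torsion-freeness enters here: on sections the sum over j collapses to nabla_X Y - nabla_Y X. *)
Lemma cov_schouten_vec_vec X Y : cov_schouten (mv_vec X) (mv_vec Y) = mv_vec (br X Y).
Proof.
rewrite -cov_torsion {2}[X]eK {3}[Y]eK !cov_sum -sumrB -mv_vec_sum.
apply: eq_bigr => j _; rewrite /schouten_term !inner_vec sgn_fun !mder_vec.
rewrite wedge_fun_vec wedge_vec_fun; apply: mv_ext => -[|a [|a' s]]; rewrite mvE /= ?subr0 //.
by rewrite linearD linearN.
Qed.

Lemma sign_boolM (p q : nat) : (-1 : R) ^+ (p * q) = (-1) ^+ (odd p && odd q).
Proof. by rewrite -[LHS]signr_odd oddM. Qed.

Lemma cov_schoutenP : is_schouten br rho cov_schouten.
Proof.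
split.
- exact: cov_schouten_linearl.
- exact: cov_schouten_linearr.
- move=> f g; apply: big1 => j _.
  by rewrite /schouten_term !inner_fun wedge0r sgn0 subr0 wedge0l.
- exact: cov_schouten_vec_fun.
- exact: cov_schouten_vec_vec.
- move=> p q P Q hP hQ; rewrite sign_boolM /=.
  by apply: cov_schouten_skew; apply: homogeneous_pure.
move=> p q P Q T hP hQ; rewrite sign_boolM /=.
by apply: cov_schouten_leibniz; apply: homogeneous_pure.
Qed.

Lemma cov_schouten_pure b c P Q : pure b P -> pure c Q ->
  pure (~~ (b (+) c)) (cov_schouten P Q).
Proof.
move=> Pb Qc; rewrite /cov_schouten; elim/big_ind: _ => [|A B|j _]; first exact: pure0.
  exact: pureD.
apply: pureD.
  by rewrite -addNb; apply: pure_wedge; [apply/pure_sgn/pure_inner|apply: pure_mder].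
by apply: pureN; rewrite -addbN; apply: pure_wedge; [apply: pure_mder|apply: pure_inner].
Qed.

Lemma wedge_degree (p q : nat) P Q : homogeneous p P -> homogeneous q Q ->
  homogeneous (p + q) (wedge P Q).
Proof.
move=> hP hQ s; elim: s p q P Q hP hQ => [|a s IH] p q P Q hP hQ.
  case: p hP => [|p] hP /=; last by rewrite hP // mul0r.
  by case: q hQ => // q hQ _; rewrite hQ // mulr0.
move=> spq; rewrite (_ : wedge P Q (a :: s) = inner a (wedge P Q) s) //.
rewrite inner_wedge mvD.
have h0 : homogeneous p (sgn P) by move=> t tp; rewrite /= /sgn_form hP // mulr0.
have hi r T : homogeneous r.+1 T -> homogeneous r (inner a T) by move=> hT t tr; exact: hT.
have hi0 T : homogeneous 0 T -> inner a T = 0.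
  by move=> hT; apply: mv_ext => t; exact: hT.
have -> : wedge (inner a P) Q s = 0.
  case: p hP spq {h0} => [|p] hP spq; first by rewrite hi0 ?wedge0l.
  by apply: (IH p q); [exact: hi| |exact: spq].
case: q hQ spq => [|q] hQ spq; first by rewrite hi0 ?wedge0r ?add0r.
by rewrite add0r (IH p q) //; [exact: hi|rewrite addnS in spq].
Qed.

(** The degree p + q - 1 is expressed without subtraction, so that for two functions no length is
    allowed and the bracket vanishes. *)
Lemma cov_schouten_degree p q P Q : homogeneous p P -> homogeneous q Q ->
  forall s, ((size s).+1 != p + q)%N -> cov_schouten P Q s = 0.
Proof.
move=> hP hQ s spq; rewrite mvE big1 // => j _; rewrite /schouten_term !mvE.
have hm E r T : homogeneous r T -> homogeneous r (mder (E : module_derivation L) T).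
  exact: (@mder_degree _ _ _ E (fun m => m != r)).
have hi r T : homogeneous r.+1 T -> homogeneous r (inner (ep j) T) by move=> hT t tr; exact: hT.
have hi0 T : homogeneous 0 T -> inner (ep j) T = 0.
  by move=> hT; apply: mv_ext => t; exact: hT.
have hs r T : homogeneous r T -> homogeneous r (sgn T).
  by move=> hT t tp; rewrite /= /sgn_form hT // mulr0.
have -> : wedge (sgn (inner (ep j) P)) (mder (cov (e j)) Q) s = 0.
  case: p hP spq => [|p] hP spq.
    by rewrite hi0 // sgn0 wedge0l.
  by apply: (wedge_degree (p := p) (q := q)) => //; [apply/hs/hi|exact: hm].
case: q hQ spq => [|q] hQ spq; first by rewrite hi0 // wedge0r subr0.
rewrite (wedge_degree (p := p) (q := q)) ?subr0 //; [exact: hm|exact: hi|].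
by rewrite addnS in spq.
Qed.

End Basis.
End Connection.

(** * Bivectors *)

Section Schouten.
Variables (R : realType) (C : comAlgType R) (L : lmodType C).
Local Notation dual := (dual L).
Local Notation mv := (multivector L).
Implicit Types (X Y Z : L) (f g : C).
Implicit Types (P Q T pi : mv) (a : dual) (b c : bool) (s t : seq dual).
Hypothesis hL : fg_projective L.

Lemma fg_vec_ext X Y : (forall a, a X = a Y) -> X = Y.
Proof. by have [n [e [ep eK]]] := dual_basis_exists hL; exact: vec_ext. Qed.

(** A dual basis supplies a section representing pi(a, .), so the choice in [sharp] is never the
    default 0. *)
Lemma sharpE pi a (a' : dual) : a' (sharp pi a) = pi [:: a; a'].
Proof.
apply: (@xgetPex _ _ [set X | forall b : dual, b X = pi [:: a; b]]).
have [n [e [ep eK]]] := dual_basis_exists hL.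
exists (\sum_j pi [:: a; ep j] *: e j) => a''.
rewrite linear_sum -[RHS]/(inner a pi [:: a'']) (dual_expand eK).
by apply: eq_bigr => j _; rewrite linearZ /= mulrC.
Qed.

Lemma sharp_basis n (e : 'I_n -> L) (ep : 'I_n -> dual) (eK : is_dual_basis e ep) pi a :
  sharp pi a = \sum_j pi [:: a; ep j] *: e j.
Proof. by rewrite [LHS]eK; apply: eq_bigr => j _; rewrite sharpE. Qed.

Lemma bivector_skew pi a (a' : dual) : pi [:: a; a'] = - pi [:: a'; a].
Proof. exact: (mv_skewP pi [::]). Qed.

Lemma dualD a X Y : a (X + Y) = a X + a Y. Proof. exact: raddfD. Qed.
Lemma dualN a X : a (- X) = - a X. Proof. exact: raddfN. Qed.
Lemma dualZ a f X : a (f *: X) = f * a X. Proof. exact: linearZ. Qed.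

Section Bracket.
Variables (br : L -> L -> L) (rho : L -> C -> C).
Hypothesis pla : pre_lie_algebroid br rho.
Local Notation S := (schouten br rho).

Lemma schoutenP : is_schouten br rho S.
Proof.
apply: (@xgetPex _ _ [set S | is_schouten br rho S]).
have [n [e [ep eK]]] := dual_basis_exists hL.
by exists (cov_schouten pla eK); exact: cov_schoutenP.
Qed.

(** By uniqueness, every dual basis computes the same bracket, so a proof may choose its own. *)
Lemma schoutenE n (e : 'I_n -> L) (ep : 'I_n -> dual) (eK : is_dual_basis e ep) P Q :
  S P Q = cov_schouten pla eK P Q.
Proof. exact: schouten_unique hL schoutenP (cov_schoutenP pla eK) P Q. Qed.

Lemma schouten_skew b c P Q : pure b P -> pure c Q ->
  S P Q = - ((-1) ^+ (~~ b && ~~ c) *: S Q P).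
Proof.
have [n [e [ep eK]]] := dual_basis_exists hL.
by rewrite !(schoutenE eK); exact: cov_schouten_skew.
Qed.

Lemma schouten_leibniz b c P Q T : pure b P -> pure c Q ->
  S P (wedge Q T) = wedge (S P Q) T + (-1) ^+ (~~ b && c) *: wedge Q (S P T).
Proof.
have [n [e [ep eK]]] := dual_basis_exists hL.
by rewrite !(schoutenE eK); exact: cov_schouten_leibniz.
Qed.

Lemma schouten_pure b c P Q : pure b P -> pure c Q -> pure (~~ (b (+) c)) (S P Q).
Proof.
have [n [e [ep eK]]] := dual_basis_exists hL.
by rewrite !(schoutenE eK); exact: cov_schouten_pure.
Qed.

Lemma schouten_degree p q P Q s : homogeneous p P -> homogeneous q Q ->
  ((size s).+1 != p + q)%N -> S P Q s = 0.
Proof.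
have [n [e [ep eK]]] := dual_basis_exists hL.
by rewrite !(schoutenE eK) => hP hQ; exact: cov_schouten_degree hP hQ _.
Qed.

Lemma schouten_comb_l (k : R) P Q T : S (k *: P + Q) T = k *: S P T + S Q T.
Proof. exact: sn_linearl schoutenP _ _ _ _. Qed.

Lemma schouten_comb_r (k : R) P Q T : S T (k *: P + Q) = k *: S T P + S T Q.
Proof. exact: sn_linearr schoutenP _ _ _ _. Qed.

Lemma schouten0l T : S 0 T = 0.
Proof. by apply: (linear_map0 (A := S^~ T)) => k P Q; rewrite schouten_comb_l. Qed.

Lemma schouten0r T : S T 0 = 0.
Proof. by apply: (linear_map0 (A := S T)) => k P Q; rewrite schouten_comb_r. Qed.

Lemma schoutenDl P Q T : S (P + Q) T = S P T + S Q T.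
Proof. by rewrite -[P]scale1r schouten_comb_l !scale1r. Qed.

Lemma schoutenDr P Q T : S T (P + Q) = S T P + S T Q.
Proof. by rewrite -[P]scale1r schouten_comb_r !scale1r. Qed.

Lemma schoutenZl (k : R) P T : S (k *: P) T = k *: S P T.
Proof. by rewrite -[k *: P]addr0 schouten_comb_l schouten0l !addr0. Qed.

Lemma schoutenZr (k : R) P T : S T (k *: P) = k *: S T P.
Proof. by rewrite -[k *: P]addr0 schouten_comb_r schouten0r !addr0. Qed.

Lemma schoutenNl P T : S (- P) T = - S P T.
Proof. by rewrite -scaleN1r schoutenZl scaleN1r. Qed.

Lemma schoutenNr P T : S T (- P) = - S T P.
Proof. by rewrite -scaleN1r schoutenZr scaleN1r. Qed.

Lemma schouten_bivector_fun pi f a : S pi (mv_fun L f) [:: a] = rho (sharp pi a) f.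
Proof.
have [n [e [ep eK]]] := dual_basis_exists hL.
rewrite (schoutenE eK) (sharp_basis eK) (anchor_sum pla) mvE; apply: eq_bigr => j _.
rewrite /schouten_term inner_fun wedge0r subr0 mder_fun /= /sgn_form /inner_form /=.
by rewrite mulr0 addr0 expr1 mulN1r -bivector_skew.
Qed.

(** Derivatives of pi are expressed by derivatives of the sections pi^# a, to which the torsion
    identity applies. *)
Lemma bivector_cov n (e : 'I_n -> L) (ep : 'I_n -> dual) (eK : is_dual_basis e ep)
    X pi a (a' : dual) :
  mder (cov pla eK X) pi [:: a; a'] =
  a' (cov_vec br rho e ep X (sharp pi a)) - a (cov_vec br rho e ep X (sharp pi a'))
  - rho X (pi [:: a; a']).
Proof.
set E := cov _ _ _.
have -> : mder E pi [:: a; a'] = pi [:: md_codual E a; a'] +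
  (pi [:: a; md_codual E a'] + rho X (pi [:: a; a'])) by [].
rewrite (bivector_skew pi (md_codual E a)) -!sharpE !md_codualE /=.
by rewrite !sharpE (bivector_skew pi a' a) (anchorN pla); ring.
Qed.

Lemma bivector_cov_sum n (e : 'I_n -> L) (ep : 'I_n -> dual) (eK : is_dual_basis e ep)
    pi a (a' : dual) (k : 'I_n -> C) :
  \sum_j k j * mder (cov pla eK (e j)) pi [:: a; a'] =
  mder (cov pla eK (\sum_j k j *: e j)) pi [:: a; a'].
Proof.
rewrite bivector_cov !(cov_sum pla eK) (anchor_sum pla) (linear_sum a) (linear_sum a') -!sumrB.
by apply: eq_bigr => j _; rewrite bivector_cov !dualZ !mulrBr.
Qed.

(** This is the Chevalley-Eilenberg formula for the Koszul bracket with anchor [rho] composed with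
    pi^#. Together with [schouten_bivector_fun] it determines [pi, .] from these two data. *)
Lemma schouten_bivector_vec pi X a (a' : dual) :
  S pi (mv_vec X) [:: a; a'] =
  rho (sharp pi a) (a' X) - rho (sharp pi a') (a X) - koszul_bracket br rho pi a a' X.
Proof.
have [n [e [ep eK]]] := dual_basis_exists hL.
pose E := cov pla eK X; pose dc := cov_vec br rho e ep.
transitivity (a' (dc (sharp pi a) X) - a (dc (sharp pi a') X) - mder E pi [:: a; a']).
  rewrite (schoutenE eK) mvE /E {4}[X]eK -bivector_cov_sum.
  rewrite !(sharp_basis eK) /dc !(cov_sum pla eK) (linear_sum a) (linear_sum a') -!sumrB.
  apply: eq_bigr => j _; rewrite /schouten_term inner_vec mder_vec mvD mvN.
  rewrite wedge_funr (dualZ a') (dualZ a); congr (_ - _).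
  rewrite /= /sgn_form /inner_form /=; rewrite ?mulr0 ?addr0 !(bivector_skew pi _ (ep j)).
  by rewrite expr1; ring.
(* All covariant derivatives are turned into the direction X, where they cancel against those of
   [bivector_cov] and leave brackets. *)
have torsion Y Z : dc Y Z = br Y Z + dc Z Y by rewrite -(cov_torsion pla eK) addrNK.
rewrite (torsion (sharp pi a)) (torsion (sharp pi a')) /koszul_bracket /lie_derivative.
rewrite /E bivector_cov !dualD -/dc.
by ring.
Qed.

Lemma wedge_form12 P Q (a1 a2 a3 : dual) : homogeneous 1 P -> homogeneous 2 Q ->
  wedge P Q [:: a1; a2; a3] =
  P [:: a1] * Q [:: a2; a3] - P [:: a2] * Q [:: a1; a3] + P [:: a3] * Q [:: a1; a2].
Proof.
move=> hP hQ; rewrite /= (hP [::]) // (hP [:: a1; a2]) // (hP [:: a1; a3]) //.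
by rewrite (hP [:: a2; a3]) // (hP [:: a1; a2; a3]) // !expr2; ring.
Qed.

Lemma schouten_bivector_bivector pi (a1 a2 a3 : dual) : homogeneous 2 pi ->
  S pi pi [:: a1; a2; a3] =
  2 * (a3 (br (sharp pi a1) (sharp pi a2)) + koszul_bracket br rho pi a1 a2 (sharp pi a3)).
Proof.
move=> hpi; have [n [e [ep eK]]] := dual_basis_exists hL.
pose D (X : L) (a b : dual) := mder (cov pla eK X) pi [:: a; b].
have sumD (F G : 'I_n -> C) : \sum_j F j + \sum_j G j = \sum_j (F j + G j).
  by rewrite big_split.
transitivity (2 * (D (sharp pi a1) a2 a3 - D (sharp pi a2) a1 a3 + D (sharp pi a3) a1 a2)).
  rewrite (schoutenE eK) mvE /D !(sharp_basis eK) -!bivector_cov_sum -sumrB sumD.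
  rewrite mulr_sumr; apply: eq_bigr => j _; rewrite /schouten_term mvD mvN.
  have hd : homogeneous 2 (mder (cov pla eK (e j)) pi).
    exact: (@mder_degree _ _ _ _ (fun m => m != 2)).
  have hi : homogeneous 1 (inner (ep j) pi) by move=> s sp; exact: hpi.
  (* The covariant derivative of pi is even and commutes with the contraction of pi, so the two
     terms of [schouten_term] coincide: this is the factor 2. *)
  rewrite (sgn_pure (homogeneous_pure hi)) wedgeZl expr1 scaleN1r mvN.
  rewrite (wedgeC (homogeneous_pure hd) (homogeneous_pure hi)) expr0 scale1r.
  rewrite !wedge_form12 //.
  have iE x : inner (ep j) pi [:: x] = - pi [:: x; ep j] by exact: bivector_skew.
  by rewrite !iE; ring.
rewrite /D !bivector_cov.
have torsion Y Z : cov_vec br rho e ep Y Z = br Y Z + cov_vec br rho e ep Z Y.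
  by rewrite -(cov_torsion pla eK) addrNK.
rewrite /koszul_bracket /lie_derivative.
rewrite (torsion (sharp pi a1) (sharp pi a2)) (torsion (sharp pi a1) (sharp pi a3)).
rewrite (torsion (sharp pi a2) (sharp pi a3)) !dualD !sharpE.
rewrite (bivector_skew pi a3 a2) (bivector_skew pi a3 a1) ?(bivector_skew pi a2 a1).
by rewrite !(anchorN pla); ring.
Qed.

End Bracket.
End Schouten.

Ltac sign_cases := rewrite /= ?expr0 ?expr1 ?scale1r ?scaleN1r.

(** * The graded Jacobi identity *)

Section Jacobi.
Variables (R : realType) (C : comAlgType R) (L : lmodType C).
Local Notation dual := (dual L).
Local Notation mv := (multivector L).
Implicit Types (X Y Z : L) (f g : C).
Implicit Types (P Q T pi : mv) (a : dual) (b c : bool) (s t : seq dual).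
Hypothesis hL : fg_projective L.

Variables (br : L -> L -> L) (rho : L -> C -> C).
Hypothesis la : lie_algebroid br rho.
Local Notation S := (schouten br rho).
Let pla := la_pre la.

(** The graded commutator of [P, .] and [Q, .] minus [[P, Q], .], applied to T; [b] and [c] are the
    intended parities of P and Q. *)
Definition jacobiator b c P Q T : mv :=
  S P (S Q T) - S (S P Q) T - (-1) ^+ (~~ b && ~~ c) *: S Q (S P T).

(** [P, .] and [Q, .] are graded derivations of the wedge product, hence so is their graded
    commutator minus [[P, Q], .]. Vanishing can thus be tested on generators in the last
    argument. *)
Lemma jacobiator_wedge b c P Q T X : pure b P -> pure c Q ->
  jacobiator b c P Q (wedge (mv_vec X) T) =
  wedge (jacobiator b c P Q (mv_vec X)) T
  + (-1) ^+ (b (+) c) *: wedge (mv_vec X) (jacobiator b c P Q T).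
Proof.
move=> Pb Qc; have Xp := @pure_vec _ _ _ X.
have PQ := schouten_pure hL pla Pb Qc.
have PX := schouten_pure hL pla Pb Xp; have QX := schouten_pure hL pla Qc Xp.
rewrite /jacobiator (schouten_leibniz hL pla _ Qc Xp) (schouten_leibniz hL pla _ Pb Xp).
rewrite (schouten_leibniz hL pla _ PQ Xp) !(schoutenDr hL pla) !(schoutenZr hL pla).
rewrite (schouten_leibniz hL pla _ Pb QX) (schouten_leibniz hL pla _ Qc PX).
rewrite (schouten_leibniz hL pla _ Qc Xp) (schouten_leibniz hL pla _ Pb Xp).
rewrite !(wedgeDl, wedgeDr, wedgeNl, wedgeNr, wedgeZl, wedgeZr).
by case: b c {Pb Qc PQ PX QX} => -[]; sign_cases; apply: mv_ext => s; rewrite !mvE; ring.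
Qed.

Lemma jacobiator_ext b c P Q : pure b P -> pure c Q ->
  (forall f, jacobiator b c P Q (mv_fun L f) = 0) ->
  (forall X, jacobiator b c P Q (mv_vec X) = 0) ->
  forall T, jacobiator b c P Q T = 0.
Proof.
move=> Pb Qc Jf JX; apply: mv_ind => //.
- by rewrite /jacobiator !(schouten0r hL pla) scaler0 !subr0.
- move=> k T1 T2 J1 J2; transitivity (k *: jacobiator b c P Q T1 + jacobiator b c P Q T2).
    rewrite /jacobiator !(schouten_comb_r hL pla).
    (* The real scalar becomes multiplication by an element of C, which [ring] can treat as an
       atom. *)
    have [K zK] : exists K : C, forall x : C, k *: x = K * x.
      by exists k%:A => x; rewrite mulr_algl.
    by apply: mv_ext => s; rewrite !mvE !signZ !zK; ring.
  by rewrite J1 J2 scaler0 addr0.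
move=> X T JT; rewrite jacobiator_wedge // JX JT wedge0l wedge0r scaler0 addr0 //.
Qed.

(** With [jacobiator_swap23], this carries vanishing to any order of the arguments, so that the
    derivation property in the last place serves all three. *)
Lemma jacobiator_swap12 b c P Q T : pure b P -> pure c Q ->
  jacobiator b c P Q T = 0 -> jacobiator c b Q P T = 0.
Proof.
move=> Pb Qc J0; rewrite -(oppr0) -(scaler0 _ ((-1) ^+ (~~ b && ~~ c) : R)) -J0.
rewrite /jacobiator (schouten_skew hL pla Qc Pb) (schoutenNl hL pla) (schoutenZl hL pla).
by case: b c {Pb Qc J0} => -[]; sign_cases; apply: mv_ext => s; rewrite !mvE; ring.
Qed.

Lemma jacobiator_swap23 b c d P Q T : pure b P -> pure c Q -> pure d T ->
  jacobiator b c P Q T = 0 -> jacobiator b d P T Q = 0.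
Proof.
move=> Pb Qc Td J0; rewrite -(oppr0) -(scaler0 _ ((-1) ^+ (~~ c && ~~ d) : R)) -J0.
have PQ := schouten_pure hL pla Pb Qc; have PT := schouten_pure hL pla Pb Td.
rewrite /jacobiator (schouten_skew hL pla Td Qc) (schouten_skew hL pla PT Qc).
rewrite (schouten_skew hL pla Td PQ) (schoutenNr hL pla) (schoutenZr hL pla).
by case: b c d {Pb Qc Td J0 PQ PT} => -[] []; sign_cases;
  apply: mv_ext => s; rewrite !mvE; ring.
Qed.

Definition generator b u : Prop :=
  if b then exists X, u = mv_vec X else exists f, u = mv_fun L f.

Lemma generator_pure b u : generator b u -> pure b u.
Proof. by case: b => -[x ->]; [exact: pure_vec|exact: pure_fun]. Qed.

Lemma schouten_fun_vec f X : S (mv_fun L f) (mv_vec X) = - mv_fun L (rho X f).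
Proof.
rewrite (schouten_skew hL pla (@pure_fun _ _ _ f) (@pure_vec _ _ _ X)) expr0 scale1r.
by rewrite (sn_vec_fun (schoutenP hL pla)).
Qed.

(** Up to order there are four cases. Three sections give the Jacobi identity of [br]; two sections
    and a function give compatibility of the anchor with brackets; with at most one section every
    term vanishes. *)
Lemma jacobiator_generators b c d P Q T :
  generator b P -> generator c Q -> generator d T -> jacobiator b c P Q T = 0.
Proof.
have [_ _ Sff SXf SXX _ _] := schoutenP hL pla; have SfX := schouten_fun_vec.
have JXXf X Y f : jacobiator true true (mv_vec X) (mv_vec Y) (mv_fun L f) = 0.
  rewrite /jacobiator !(SXf, SXX) (la_anchor la) expr0 scale1r.
  by apply: mv_ext => -[|a s]; rewrite !mvE /=; ring.
have JXff X f g : jacobiator true false (mv_vec X) (mv_fun L f) (mv_fun L g) = 0.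
  by rewrite /jacobiator !(SXf, Sff) (schouten0r hL pla) scaler0 !subr0.
have Jfff f g k : jacobiator false false (mv_fun L f) (mv_fun L g) (mv_fun L k) = 0.
  by rewrite /jacobiator !Sff !(schouten0r hL pla) (schouten0l hL pla) scaler0 !subr0.
have JXXX X Y Z : jacobiator true true (mv_vec X) (mv_vec Y) (mv_vec Z) = 0.
  rewrite /jacobiator !SXX expr0 scale1r.
  have J : br X (br Y Z) = br (br X Y) Z + br Y (br X Z).
    rewrite (pla_br_skew pla (br X Y)) (pla_br_skew pla X Z) (br_oppr pla) -opprD.
    by apply/eqP; rewrite -addr_eq0 [X in _ + X]addrC addrA (la_jacobi la).
  by apply: mv_ext => -[|a [|a' s]]; rewrite !mvE /= ?J ?dualD; ring.
have pf f := @pure_fun _ _ L f; have pX X := @pure_vec _ _ _ X.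
case: b => -[x ->]; case: c => -[y ->]; case: d => -[z ->].
- exact: JXXX.
- exact: JXXf.
- exact: (jacobiator_swap23 (pX x) (pX z) (pf y)).
- exact: JXff.
- exact: (jacobiator_swap12 (pX y) (pf x) (jacobiator_swap23 (pX y) (pX z) (pf x) _)).
- exact: (jacobiator_swap12 (pX y) (pf x)).
- exact: (jacobiator_swap23 (pf x) (pX z) (pf y) (jacobiator_swap12 (pX z) (pf x) _)).
exact: Jfff.
Qed.

Lemma jacobiator_generator_ext b c P Q : pure b P -> pure c Q ->
  (forall d u, generator d u -> jacobiator b c P Q u = 0) ->
  forall T, jacobiator b c P Q T = 0.
Proof.
move=> Pb Qc J; apply: jacobiator_ext => // [f|X].
  by apply: (J false); exists f.
by apply: (J true); exists X.
Qed.

(** Generators are replaced by arbitrary elements one argument at a time, each extension taking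
    place in the last position after suitable swaps. *)
Lemma schouten_jacobi b c d P Q T : pure b P -> pure c Q -> pure d T ->
  S P (S Q T) = S (S P Q) T + (-1) ^+ (~~ b && ~~ c) *: S Q (S P T).
Proof.
move=> Pb Qc Td; suff /eqP : jacobiator b c P Q T = 0.
  by rewrite /jacobiator -addrA -opprD subr_eq0 => /eqP.
have J1 b1 c1 u v : generator b1 u -> generator c1 v -> forall W, jacobiator b1 c1 u v W = 0.
  move=> gu gv; apply: jacobiator_generator_ext => [||d1 w gw]; try exact: generator_pure.
  exact: jacobiator_generators gw.
have J2 b1 c1 u V : generator b1 u -> pure c1 V -> forall W, jacobiator b1 c1 u V W = 0.
  move=> gu Vc; have pu := generator_pure gu.
  apply: jacobiator_generator_ext => // d1 w gw.
  by apply: (jacobiator_swap23 pu (generator_pure gw) Vc); exact: J1.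
apply: jacobiator_generator_ext => // d1 w gw; have pw := generator_pure gw.
apply: (jacobiator_swap23 Pb pw Qc); apply: (jacobiator_swap12 pw Pb).
exact: J2.
Qed.

End Jacobi.

(** * Deformation by a (1,1)-tensor *)

Section Deformation.
Variables (R : realType) (C : comAlgType R) (L : lmodType C).
Local Notation dual := (dual L).
Local Notation mv := (multivector L).
Implicit Types (X Y Z : L) (f g : C).
Implicit Types (P Q T pi : mv) (a b : dual) (s t : seq dual).
Implicit Types (br : L -> L -> L) (rho : L -> C -> C) (N M : {linear L -> L}).
Hypothesis hL : fg_projective L.
Local Notation vec_ext := (fg_vec_ext hL).

Lemma mapD N X Y : N (X + Y) = N X + N Y. Proof. exact: linearD. Qed.
Lemma mapN N X : N (- X) = - N X. Proof. exact: linearN. Qed.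
Lemma mapZ N f X : N (f *: X) = f *: N X. Proof. exact: linearZ. Qed.

Lemma jacobi_rot br rho X Y Z : lie_algebroid br rho ->
  br X (br Y Z) = - br Y (br Z X) - br Z (br X Y).
Proof. by move=> la; apply/eqP; rewrite -subr_eq0 opprB opprK addrA addrAC (la_jacobi la). Qed.

Lemma deformedE br N X Y :
  deformed_br br N X Y = br (N X) Y + br X (N Y) - N (br X Y).
Proof. by []. Qed.

Lemma deformed_pre br rho N : pre_lie_algebroid br rho ->
  pre_lie_algebroid (deformed_br br N) (deformed_anchor rho N).
Proof.
move=> pla; rewrite /deformed_br /deformed_anchor; split.
- move=> c X Y Z; rewrite (mapD N) (mapZ N) !(pla_br_linear pla) (mapD N) (mapZ N) /=.
  by apply: vec_ext => a; rewrite !(dualD a, dualN a, dualZ a); ring.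
- move=> X Y; rewrite (pla_br_skew pla X (N Y)) (pla_br_skew pla (N X)) (pla_br_skew pla X Y).
  by rewrite (mapN N); apply: vec_ext => a; rewrite !(dualD a, dualN a, dualZ a); ring.
- by move=> f X Y g; rewrite (mapD N) (mapZ N) (pla_rho_linear pla).
- by move=> X c f g; rewrite (pla_rho_scalar pla).
- by move=> X f g; rewrite (pla_rho_derivation pla).
move=> X Y f; rewrite (mapZ N) !(pla_leibniz pla) (mapD N) !(mapZ N) /=.
by apply: vec_ext => a; rewrite !(dualD a, dualN a, dualZ a); ring.
Qed.

Lemma deformed_lie br rho N : lie_algebroid br rho -> nijenhuis br N ->
  lie_algebroid (deformed_br br N) (deformed_anchor rho N).
Proof.
move=> la nN; have pla := la_pre la; split; first exact: deformed_pre.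
  (* The Nijenhuis condition sorts the double bracket into terms with N on two arguments, N of those
     with N on one, and N^2 of the one with none. In the cyclic sum these groups cancel by seven
     Jacobi identities of [br]. *)
  have dd X Y Z : deformed_br br N X (deformed_br br N Y Z) =
    br (N X) (br (N Y) Z) + br (N X) (br Y (N Z)) + br X (br (N Y) (N Z))
    - N (br (N X) (br Y Z) + br X (br (N Y) Z) + br X (br Y (N Z)))
    + N (N (br X (br Y Z))).
    rewrite {1}/deformed_br -nN {1 2}/deformed_br !(br_addr pla) !(br_oppr pla).
    rewrite !(mapD N) !(mapN N) /=.
    rewrite (nN X (br Y Z)) /deformed_br !(mapD N) !(mapN N) /=.
    by apply: vec_ext => a; rewrite !(dualD a, dualN a, dualZ a); ring.
  move=> X Y Z; rewrite !dd.
  rewrite (jacobi_rot (N X) (N Y) Z la) (jacobi_rot (N X) Y (N Z) la).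
  rewrite (jacobi_rot X (N Y) (N Z) la) (jacobi_rot (N X) Y Z la).
  rewrite (jacobi_rot X (N Y) Z la) (jacobi_rot X Y (N Z) la) (jacobi_rot X Y Z la).
  rewrite !(mapD N) !(mapN N) /=.
  by apply: vec_ext => a; rewrite !(dualD a, dualN a, dualZ a); ring.
by move=> X Y f; rewrite /deformed_anchor -nN (la_anchor la).
Qed.

Lemma deformed_nijenhuis br rho N : pre_lie_algebroid br rho -> nijenhuis br N ->
  nijenhuis (deformed_br br N) N.
Proof.
move=> pla nN X Y; by rewrite (deformedE (deformed_br br N)) (mapD N) (mapN N) (mapD N) -!nN.
Qed.

Lemma deformed_twice br rho N : pre_lie_algebroid br rho -> nijenhuis br N ->
  deformed_br (deformed_br br N) N = deformed_br br (N \o N).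
Proof.
move=> pla nN; apply/funext => X; apply/funext => Y.
rewrite {1}/deformed_br -nN /deformed_br /=.
apply: vec_ext => a; rewrite nN /deformed_br !(mapD N) !(mapN N) /=.
by rewrite !(dualD a, dualN a, dualZ a); ring.
Qed.

(** [deformed_br br M] is the coboundary of M for [br], so the mixed terms of the Jacobi identity
    cancel by Jacobi for [br] with M on one argument; the remaining terms are the Jacobi identities
    of the two summands. *)
Lemma add_deformed_lie br rho M : lie_algebroid br rho ->
  lie_algebroid (deformed_br br M) (deformed_anchor rho M) ->
  lie_algebroid (fun X Y => br X Y + deformed_br br M X Y)
    (fun X f => rho X f + deformed_anchor rho M X f).
Proof.
move=> la laM; have pla := la_pre la; have plaM := la_pre laM.
(* [B] stays opaque so that its own Jacobi identity is used as a whole before [-BE] expands the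
   mixed terms. *)
have [B BE] : exists B, deformed_br br M = B by exists (deformed_br br M).
rewrite BE in laM plaM *; split.
- split.
  + move=> c X Y Z; rewrite (pla_br_linear pla) (pla_br_linear plaM).
    by rewrite scalerDr addrACA.
  + by move=> X Y; rewrite (pla_br_skew pla) (pla_br_skew plaM) opprD.
  + by move=> f X Y g; rewrite (pla_rho_linear pla) (pla_rho_linear plaM); ring.
  + by move=> X c f g; rewrite (pla_rho_scalar pla) (pla_rho_scalar plaM) scalerDr addrACA.
  + by move=> X f g; rewrite (pla_rho_derivation pla) (pla_rho_derivation plaM); ring.
  move=> X Y f; rewrite (pla_leibniz pla) (pla_leibniz plaM).
  by apply: vec_ext => a; rewrite !(dualD a, dualN a, dualZ a); ring.
- move=> X Y Z; rewrite !(br_addr pla) !(br_addr plaM).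
  rewrite (jacobi_rot X Y Z la) (jacobi_rot X Y Z laM) -BE /deformed_br.
  rewrite !(br_addr pla) !(br_oppr pla).
  rewrite (jacobi_rot X (M Y) Z la) (jacobi_rot (M X) Y Z la) (jacobi_rot X Y (M Z) la).
  rewrite (jacobi_rot X Y Z la) !(mapD M) !(mapN M) /=.
  by apply: vec_ext => a; rewrite !(dualD a, dualN a, dualZ a); ring.
move=> X Y f; rewrite (anchor_vecD pla) (la_anchor la) (anchor_vecD plaM) (la_anchor laM).
rewrite -BE /deformed_anchor /deformed_br !(anchor_vecD pla) (anchor_vecN pla) !(la_anchor la).
by rewrite !(anchorD pla); ring.
Qed.

(** The defining axioms are linear in bracket, anchor and [S] jointly, so the sum satisfies them and
    uniqueness applies. *)
Lemma add_schouten br1 rho1 br2 rho2 P Q :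
  let br X Y := br1 X Y + br2 X Y in
  let rho X f := rho1 X f + rho2 X f in
  pre_lie_algebroid br1 rho1 -> pre_lie_algebroid br2 rho2 ->
  pre_lie_algebroid br rho ->
  schouten br rho P Q = schouten br1 rho1 P Q + schouten br2 rho2 P Q.
Proof.
move=> br rho pla1 pla2 pla.
have h1 := schoutenP hL pla1; have h2 := schoutenP hL pla2.
apply: (schouten_unique hL (schoutenP hL pla)
  (S2 := fun P Q => schouten br1 rho1 P Q + schouten br2 rho2 P Q)); split.
- by move=> c P1 P2 T; rewrite (sn_linearl h1) (sn_linearl h2) scalerDr addrACA.
- by move=> c P1 P2 T; rewrite (sn_linearr h1) (sn_linearr h2) scalerDr addrACA.
- by move=> f g; rewrite (sn_fun_fun h1) (sn_fun_fun h2) addr0.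
- move=> X f; rewrite (sn_vec_fun h1) (sn_vec_fun h2).
  by apply: mv_ext => -[|a s]; rewrite !mvE /= ?addr0.
- move=> X Y; rewrite (sn_vec_vec h1) (sn_vec_vec h2).
  by apply: mv_ext => -[|a [|a' s]]; rewrite !mvE /= ?addr0 ?(dualD a).
- move=> p q P1 Q1 hP hQ; rewrite (sn_skew h1 hP hQ) (sn_skew h2 hP hQ).
  by rewrite scalerDr opprD.
move=> p q P1 Q1 T hP hQ; rewrite (sn_leibniz h1 _ hP hQ) (sn_leibniz h2 _ hP hQ).
by rewrite wedgeDl wedgeDr scalerDr addrACA.
Qed.

Lemma lin_md_homogeneous N p P : homogeneous p P -> homogeneous p (mder (lin_md N) P).
Proof. exact: (@mder_degree _ _ _ _ (fun m => m != p)). Qed.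

Lemma lin_md_fun N f : mder (lin_md N) (mv_fun L f) = 0.
Proof. by rewrite mder_fun; apply: mv_ext => -[]. Qed.

Lemma mderD (E : module_derivation L) P Q : mder E (P + Q) = mder E P + mder E Q.
Proof. by rewrite -[P]scale1r mder_linear !scale1r. Qed.

Lemma mder0 (E : module_derivation L) : mder E 0 = 0.
Proof. exact: (linear_map0 (mder_linear E)). Qed.

Lemma mderZ (E : module_derivation L) (k : R) P : mder E (k *: P) = k *: mder E P.
Proof. by rewrite -[k *: P]addr0 mder_linear mder0 addr0. Qed.

Lemma mderN (E : module_derivation L) P : mder E (- P) = - mder E P.
Proof. by rewrite -scaleN1r mderZ scaleN1r. Qed.

Lemma deformed_schouten br rho N P Q : pre_lie_algebroid br rho ->
  let D := mder (lin_md N) in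
  schouten (deformed_br br N) (deformed_anchor rho N) P Q =
  schouten br rho (D P) Q + schouten br rho P (D Q) - D (schouten br rho P Q).
Proof.
move=> pla D; have h := schoutenP hL pla.
apply: (schouten_unique hL (schoutenP hL (deformed_pre N pla)) (S2 := fun P Q =>
  schouten br rho (D P) Q + schouten br rho P (D Q) - D (schouten br rho P Q))).
have DX X : D (mv_vec X) = mv_vec (N X) by exact: mder_vec.
have Df f : D (mv_fun L f) = 0 by exact: lin_md_fun.
have hom p T : homogeneous p T -> homogeneous p (D T) by exact: lin_md_homogeneous.
split.
- move=> c P1 P2 T; rewrite /D !mder_linear !(sn_linearl h) mder_linear.
  by rewrite !scalerDr scalerN; apply: mv_ext => s; rewrite !mvE; ring.
- move=> c P1 P2 T; rewrite /D !mder_linear !(sn_linearr h) mder_linear.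
  by rewrite !scalerDr scalerN; apply: mv_ext => s; rewrite !mvE; ring.
- move=> f g; rewrite !Df !(sn_fun_fun h) (schouten0l hL pla) (schouten0r hL pla).
  by rewrite /D mder0 !addr0 subr0.
- move=> X f; rewrite DX Df !(sn_vec_fun h) (schouten0r hL pla) Df.
  by rewrite addr0 subr0.
- move=> X Y; rewrite !DX !(sn_vec_vec h) DX.
  by apply: mv_ext => -[|a [|a' s]]; rewrite !mvE /= ?subr0 ?addr0 // !(dualD a, dualN a).
- move=> p q P1 Q1 hP hQ; rewrite (sn_skew h (hom _ _ hP) hQ) (sn_skew h hP (hom _ _ hQ)).
  rewrite (sn_skew h hP hQ) /D mderN mderZ !scalerDr scalerN.
  by apply: mv_ext => s; rewrite !mvE; ring.
move=> p q P1 Q1 T hP hQ; have DP := hom _ _ hP; have DQ := hom _ _ hQ.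
rewrite /D mder_wedge !(schoutenDr hL pla) !(sn_leibniz h _ hP hQ) (sn_leibniz h _ DP hQ).
rewrite (sn_leibniz h _ hP DQ) mderD mderZ !mder_wedge.
rewrite !(wedgeDl, wedgeDr, wedgeNl, wedgeNr) !scalerDr !scalerN -/D.
by apply: mv_ext => s; rewrite !mvE; ring.
Qed.

(** Both operators obey the same Leibniz rule and on generators involve only the data compared here.
    The two algebroid structures may differ, which allows comparing pi_N on A with pi on A_N. *)
Lemma eq_schouten_bivector br1 rho1 pi1 br2 rho2 pi2 :
  pre_lie_algebroid br1 rho1 -> pre_lie_algebroid br2 rho2 ->
  homogeneous 2 pi1 -> homogeneous 2 pi2 ->
  (forall a f, rho1 (sharp pi1 a) f = rho2 (sharp pi2 a) f) ->
  (forall a b X, koszul_bracket br1 rho1 pi1 a b X = koszul_bracket br2 rho2 pi2 a b X) ->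
  forall P, schouten br1 rho1 pi1 P = schouten br2 rho2 pi2 P.
Proof.
move=> pla1 pla2 h1 h2 erho ekos.
apply: mv_ind => //.
- by rewrite (schouten0r hL pla1) (schouten0r hL pla2).
- by move=> c P Q e1 e2; rewrite (schouten_comb_r hL pla1) (schouten_comb_r hL pla2) e1 e2.
- move=> f; apply: mv_ext => s; have hf := @homogeneous_fun _ _ L f.
  case: s => [|a [|b s]]; last 1 first.
  + by rewrite (schouten_degree hL pla1 h1 hf) // (schouten_degree hL pla2 h2 hf).
  + by rewrite (schouten_degree hL pla1 h1 hf) // (schouten_degree hL pla2 h2 hf).
  by rewrite (schouten_bivector_fun hL pla1) (schouten_bivector_fun hL pla2).
have eX X : schouten br1 rho1 pi1 (mv_vec X) = schouten br2 rho2 pi2 (mv_vec X).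
  apply: mv_ext => s; have hX := @homogeneous_vec _ _ _ X.
  have [|s2] := eqVneq (size s) 2%N; last first.
    by rewrite (schouten_degree hL pla1 h1 hX) // (schouten_degree hL pla2 h2 hX).
  case: s => [|a [|b [|]]] // _.
  by rewrite (schouten_bivector_vec hL pla1) (schouten_bivector_vec hL pla2) !erho ekos.
move=> X P eP; have hX := @homogeneous_vec _ _ _ X.
rewrite (sn_leibniz (schoutenP hL pla1) _ h1 hX) (sn_leibniz (schoutenP hL pla2) _ h2 hX).
by rewrite eX eP.
Qed.

End Deformation.

(** * Poisson-Nijenhuis pairs *)

Section PoissonNijenhuis.
Variables (R : realType) (C : comAlgType R) (L : lmodType C).
Local Notation dual := (dual L).
Local Notation mv := (multivector L).
Implicit Types (X Y Z : L) (f g : C).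
Implicit Types (P Q T pi : mv) (a b : dual) (s t : seq dual).
Implicit Types (br : L -> L -> L) (rho : L -> C -> C) (N M : {linear L -> L}).
Hypothesis hL : fg_projective L.

(* The Magri-Morosi concomitant, i.e. {.,.}_(pi_N) minus the deformation of {.,.}_pi by N^*. *)
Definition concomitant br rho pi N a b Y : C :=
  a (br (sharp pi b) (N Y)) - a (N (br (sharp pi b) Y))
  - b (br (sharp pi a) (N Y)) + b (N (br (sharp pi a) Y))
  + rho Y (b (N (sharp pi a))) - rho (N Y) (b (sharp pi a)).

Lemma twice_eq0 (x : C) : 2 * x = 0 -> x = 0.
Proof.
rewrite mulr_natl -scaler_nat => /(congr1 (fun y => (2%:R^-1 : R) *: y)).
by rewrite scaler0 scalerA mulVf ?scale1r // pnatr_eq0.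
Qed.

(** The second summand is -<c, pi^# {a, b}> by skewness of pi, written so because [koszul_bracket]
    is a bare function of sections, to which [sharp] does not apply. *)
Lemma poissonE br rho pi : pre_lie_algebroid br rho ->
  poisson br rho pi <-> homogeneous 2 pi /\
  forall a b c : dual,
    c (br (sharp pi a) (sharp pi b)) + koszul_bracket br rho pi a b (sharp pi c) = 0.
Proof.
move=> pla; split=> -[hpi pipi]; split=> //.
  move=> a b c; apply: twice_eq0.
  by rewrite -(schouten_bivector_bivector hL pla) // pipi.
apply: mv_ext => s; have [s3|s3] := eqVneq (size s) 3%N; last first.
  by rewrite (schouten_degree hL pla hpi hpi).
case: s s3 => [|a [|b [|c [|]]]] // _.
by rewrite (schouten_bivector_bivector hL pla) // pipi mulr0.
Qed.

(* A Poisson-Nijenhuis structure, with (2) read as: pi^# is a morphism from {.,.}_pi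
   to br, and (4) as the vanishing of the concomitant. *)
Record pn_pair br rho pi N : Prop := {
  pp_lie : lie_algebroid br rho;
  pp_nijenhuis : nijenhuis br N;
  pp_homogeneous : homogeneous 2 pi;
  pp_poisson : forall a b c : dual,
    c (br (sharp pi a) (sharp pi b)) + koszul_bracket br rho pi a b (sharp pi c) = 0;
  pp_sharp : forall a, sharp pi (transp N a) = N (sharp pi a);
  pp_concomitant : forall a b Y, concomitant br rho pi N a b Y = 0 }.

Lemma transpE N a X : transp N a X = a (N X). Proof. by []. Qed.

(** The deformation of {.,.}_pi by the transpose of N, the bracket {.,.}_(pi_N) and {.,.}_pi^N form
    an arithmetic progression with the concomitant as step. Condition (4) equates the two ends,
    hence all three. *)
Lemma concomitantE br rho pi N a b Y : pre_lie_algebroid br rho ->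
  (forall a, sharp pi (transp N a) = N (sharp pi a)) ->
  koszul_bracket br rho pi (transp N a) b Y
    + koszul_bracket br rho pi a (transp N b) Y
    - koszul_bracket br rho pi a b (N Y)
  = koszul_bracket (deformed_br br N) (deformed_anchor rho N) pi a b Y
    - 2 * concomitant br rho pi N a b Y.
Proof.
move=> pla sN; rewrite /koszul_bracket /lie_derivative /concomitant.
rewrite -!(sharpE hL) !sN /deformed_br /deformed_anchor !transpE.
by rewrite !(dualD a, dualD b, dualN a, dualN b); ring.
Qed.

Lemma pn_pairP br rho pi N : lie_algebroid br rho ->
  poisson_nijenhuis br rho pi N <-> pn_pair br rho pi N.
Proof.
move=> la; have pla := la_pre la; split=> -[].
  move=> nN /(poissonE _ pla)[hpi po] sN cpt; split=> //.
  move=> a b Y; apply: twice_eq0; apply/eqP; rewrite -oppr_eq0; apply/eqP.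
  have := cpt a b Y; rewrite concomitantE // => /eqP.
  by rewrite -subr_eq0 addrAC subrr add0r => /eqP.
move=> _ nN hpi po sN co; split=> //.
  by apply/poissonE.
by move=> a b X; rewrite concomitantE // co mulr0 subr0.
Qed.

Section Pair.
Variables (br : L -> L -> L) (rho : L -> C -> C) (pi : mv) (N : {linear L -> L}).
Hypothesis pn : pn_pair br rho pi N.
Let la := pp_lie pn.
Let pla := la_pre la.
Let sN := pp_sharp pn.
Let nN := pp_nijenhuis pn.
Let co := pp_concomitant pn.

Lemma pair_koszul a b Y :
  koszul_bracket (deformed_br br N) (deformed_anchor rho N) pi a b Y =
  koszul_bracket br rho pi (transp N a) b Y
    + koszul_bracket br rho pi a (transp N b) Y
    - koszul_bracket br rho pi a b (N Y).
Proof. by rewrite concomitantE // co mulr0 subr0. Qed.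

Lemma pair_poisson a b c :
  koszul_bracket br rho pi a b (sharp pi c) = - c (br (sharp pi a) (sharp pi b)).
Proof. by apply/eqP; rewrite -addr_eq0 addrC (pp_poisson pn). Qed.

Lemma deformed_pair : pn_pair (deformed_br br N) (deformed_anchor rho N) pi N.
Proof.
split.
- exact: (deformed_lie hL).
- exact: (deformed_nijenhuis pla).
- exact: (pp_homogeneous pn).
(* N (pi^# c) is pi^# of the transposed c, so the Poisson property evaluates all three Koszul
   brackets. *)
- move=> a b c; rewrite pair_koszul -sN !pair_poisson !sN transpE.
  by rewrite /deformed_br !(dualD c, dualN c); ring.
- exact: sN.
(* Modulo the Nijenhuis condition, the concomitant for the deformed bracket at Y is the one for [br]
   at N Y. *)
move=> a b Y; rewrite -[RHS](co a b (N Y)) /concomitant /deformed_anchor /deformed_br.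
rewrite !(mapD N) !(mapN N) !(dualD a, dualN a, dualD b, dualN b) !nN /deformed_br.
by rewrite !(mapD N) !(mapN N) !(dualD a, dualN a, dualD b, dualN b); ring.
Qed.

(** Witness for [bivector_N]: by condition (3) the two terms of the derivation on pi agree, so half
    of it has the values <b, N pi^# a> and is visibly skew. *)
Definition half_bivector : mv := (2^-1 : R) *: mder (lin_md N) pi.

Lemma lin_md_bivector a b : mder (lin_md N) pi [:: a; b] = 2 * b (N (sharp pi a)).
Proof.
have tE a' : md_codual (lin_md N) a' = transp N a' by apply: dual_ext => X; rewrite /= subr0.
rewrite /= /inner_form !tE addr0 -!(sharpE hL) sN transpE; ring.
Qed.

Lemma bivectorN_spec : homogeneous 2 (bivector_N pi N) /\
  forall a b, bivector_N pi N [:: a; b] = b (N (sharp pi a)).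
Proof.
apply: (@xgetPex _ _ [set Q | homogeneous 2 Q /\
  forall a b : dual, Q [:: a; b] = b (N (sharp pi a))]).
exists half_bivector; split=> [s s2|a b]; rewrite mvE.
  by rewrite (lin_md_homogeneous N (pp_homogeneous pn)) ?scaler0.
rewrite lin_md_bivector; set x := b _.
rewrite (_ : 2 * x = (2%:R : R) *: x) ?scaler_nat ?mulr_natl // -scaler_nat.
by rewrite scalerA mulVf ?scale1r // pnatr_eq0.
Qed.

Lemma lin_md_pi : mder (lin_md N) pi = 2%:R *: bivector_N pi N.
Proof.
have [h2 e2] := bivectorN_spec; apply: mv_ext => s; rewrite mvE.
have [|s2] := eqVneq (size s) 2%N; last first.
  by rewrite h2 // scaler0 (lin_md_homogeneous N (pp_homogeneous pn)).
case: s => [|a [|b [|]]] // _.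
by rewrite lin_md_bivector e2 scaler_nat mulr_natl.
Qed.

Lemma sharp_bivectorN a : sharp (bivector_N pi N) a = N (sharp pi a).
Proof.
by apply: (fg_vec_ext hL) => b; rewrite (sharpE hL); have [_ ->] := bivectorN_spec.
Qed.

Lemma bivectorN_koszul a b Y :
  koszul_bracket br rho (bivector_N pi N) a b Y =
  koszul_bracket (deformed_br br N) (deformed_anchor rho N) pi a b Y.
Proof.
rewrite -[RHS]subr0 -(co a b Y).
rewrite /koszul_bracket /lie_derivative /concomitant /deformed_br /deformed_anchor.
rewrite -!(sharpE hL) !sharp_bivectorN !(dualD a, dualD b, dualN a, dualN b).
ring.
Qed.

Lemma bivectorN_pair : pn_pair br rho (bivector_N pi N) N.
Proof.
split=> //.
- by case: bivectorN_spec.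
- move=> a b c; rewrite bivectorN_koszul pair_koszul !sharp_bivectorN -!sN !pair_poisson.
  rewrite !sN !transpE nN /deformed_br.
  by rewrite !(mapD N) !(mapN N) !(dualD c, dualN c); ring.
- by move=> a; rewrite !sharp_bivectorN sN.
(* Modulo the Nijenhuis condition, the concomitant of pi_N at (a, b) is that of pi with a replaced
   by its transpose under N. *)
move=> a b Y; rewrite -[RHS](co (transp N a) b Y) /concomitant !sharp_bivectorN !sN !transpE.
rewrite !nN /deformed_br.
by rewrite !(mapD N) !(mapN N) !(dualD a, dualN a, dualD b, dualN b); ring.
Qed.

Lemma bivectorN_schouten P :
  schouten (deformed_br br N) (deformed_anchor rho N) pi P =
  schouten br rho (bivector_N pi N) P.
Proof.
apply/esym; apply: (eq_schouten_bivector hL) => //.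
- exact: (deformed_pre hL).
- by case: bivectorN_spec.
- exact: (pp_homogeneous pn).
- by move=> a f; rewrite sharp_bivectorN.
exact: bivectorN_koszul.
Qed.

Lemma sharpN a : sharp (- pi) a = - sharp pi a.
Proof.
by apply: (fg_vec_ext hL) => b; rewrite (sharpE hL) (dualN b) (sharpE hL) mvN.
Qed.

(** The Poisson condition is quadratic in pi and the two compatibility conditions are linear, so all
    survive the sign that each bracketing with N introduces. *)
Lemma opp_pair : pn_pair br rho (- pi) N.
Proof.
have ko a b Y : koszul_bracket br rho (- pi) a b Y = - koszul_bracket br rho pi a b Y.
  rewrite /koszul_bracket /lie_derivative -!(sharpE hL) !sharpN (dualN b).
  rewrite !(br_oppl pla) !(anchor_vecN pla) (anchorN pla) (dualN a) (dualN b); ring.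
split=> //.
- by move=> s s2; rewrite mvN (pp_homogeneous pn) ?oppr0.
- move=> a b c; rewrite ko !sharpN (br_oppl pla) (br_oppr pla) opprK.
  have -> : koszul_bracket br rho pi a b (- sharp pi c) =
      - koszul_bracket br rho pi a b (sharp pi c).
    rewrite /koszul_bracket /lie_derivative !(br_oppr pla) !(anchor_vecN pla).
    by rewrite !(dualN a) !(dualN b) !(anchorN pla); ring.
  by rewrite opprK (pp_poisson pn).
- by move=> a; rewrite !sharpN sN (mapN N).
move=> a b Y; rewrite -[RHS]oppr0 -(co a b Y) /concomitant !sharpN !(mapN N).
rewrite !(br_oppl pla) !(mapN N) !(dualN a) !(dualN b) !(anchorN pla); ring.
Qed.

End Pair.

End PoissonNijenhuis.

(** * Unshuffles and insertions *)

Section Unshuffles.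

Lemma increasing_eq m (f g : 'I_m -> nat) :
  (forall i j : 'I_m, (i < j)%N -> (f i < f j)%N) ->
  (forall i j : 'I_m, (i < j)%N -> (g i < g j)%N) ->
  (forall x, (exists i, x = f i) <-> (exists i, x = g i)) -> f =1 g.
Proof.
move=> fi gi fg.
have srt h : (forall i j : 'I_m, (i < j)%N -> (h i < h j)%N) ->
    sorted ltn [seq h i | i <- enum 'I_m].
  move=> hi; apply: (homo_sorted (e := relpre val ltn)) => [i j|]; first exact: hi.
  by rewrite -(sorted_map (f := val)) val_enum_ord iota_ltn_sorted.
have/eq_in_map h : [seq f i | i <- enum 'I_m] = [seq g i | i <- enum 'I_m].
  apply: (irr_sorted_eq ltn_trans ltnn); rewrite ?srt // => x.
  apply/mapP/mapP => -[i _ xi].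
    have [|j ->] := (fg x).1; first by exists i.
    by exists j; rewrite ?mem_enum.
  have [|j ->] := (fg x).2; first by exists i.
  by exists j; rewrite ?mem_enum.
by move=> i; apply: h; rewrite mem_enum.
Qed.

Lemma increasing_perm n (s : 'S_n) :
  (forall i j : 'I_n, (i < j)%N -> (s i < s j)%N) -> s = 1%g.
Proof.
move=> si; apply/permP => i; rewrite perm1; apply: val_inj.
apply: (increasing_eq (f := fun i => s i) (g := val)) => // x; split=> -[j ->].
  by exists (s j).
by exists (s^-1 j)%g; rewrite permKV.
Qed.

Lemma unshuffle_full n (s : 'S_n) : is_unshuffle n s = (s == 1%g).
Proof.
apply/idP/eqP => [/forallP us|->].
  apply: increasing_perm => i j ij; have /forallP/(_ j)/implyP := us i.
  by apply; rewrite ij ltn_ord.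
by apply/forallP => i; apply/forallP => j; apply/implyP; rewrite !perm1 => /andP[].
Qed.

Lemma lift_perm_max_val n (j i : 'I_n.+1) :
  lift_perm ord_max j 1 i = (if i == n :> nat then j : nat else bump j i) :> nat.
Proof.
case: (unliftP ord_max i) => [k ->|->]; last by rewrite lift_perm_id eqxx.
by rewrite lift_perm_lift perm1 lift_max (ltn_eqF (ltn_ord k)).
Qed.

(** Such an unshuffle is determined by the index in last position, the others keeping their order.
    As forms of arity at most two leave at most one argument outside the inner form, only this case
    and [unshuffle_full] matter. *)
Lemma unshuffle_last n (s : 'S_n.+1) :
  is_unshuffle n s = (s == lift_perm ord_max (s ord_max) 1%g).
Proof.
apply/idP/eqP => [/forallP us|->]; last first.
  apply/forallP => i; apply/forallP => j; apply/implyP => /andP[ij].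
  rewrite [(n <= i)%N]leqNgt (leq_trans ij (ltn_ord j)) orbF => jn.
  rewrite !lift_perm_max_val (ltn_eqF jn) (ltn_eqF (ltn_trans ij jn)).
  by rewrite ltn_neqAle leq_bump2 (can_eq (@bumpK _)) -ltn_neqAle.
apply/permP => i; case: (unliftP ord_max i) => [k ->|->]; last by rewrite lift_perm_id.
rewrite lift_perm_lift perm1; apply: val_inj.
apply: (increasing_eq (f := fun k => s (lift ord_max k))
  (g := fun k => lift (s ord_max) k)) => [i1 j1 ij|i1 j1 ij|x].
- have /forallP/(_ (lift ord_max j1))/implyP := us (lift ord_max i1).
  by apply; rewrite !lift_max ij ltn_ord.
- by rewrite /= ltn_neqAle leq_bump2 (can_eq (@bumpK _)) -ltn_neqAle.
split=> -[k1 ->].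
  case: (unliftP (s ord_max) (s (lift ord_max k1))) => [k2 ->|/perm_inj]; first by exists k2.
  by move/eqP; rewrite eq_sym (negPf (neq_lift _ _)).
case: (unliftP ord_max (s^-1 (lift (s ord_max) k1))%g) => [k2 e2|/(congr1 s)].
  by exists k2; rewrite -e2 permKV.
by rewrite permKV => /eqP; rewrite eq_sym (negPf (neq_lift _ _)).
Qed.

Lemma sum_unshuffle_last (V : nmodType) n (G : 'S_n.+1 -> V) :
  \sum_(s | is_unshuffle n s) G s = \sum_(j < n.+1) G (lift_perm ord_max j 1%g).
Proof.
rewrite (reindex_onto (fun j => lift_perm ord_max j 1%g) (fun s : 'S_n.+1 => s ord_max)) /=.
  by apply: eq_bigl => j; rewrite unshuffle_last lift_perm_id !eqxx.
by move=> s; rewrite unshuffle_last => /eqP <-.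
Qed.

End Unshuffles.

Section KoszulSigns.
Variable R : realType.

Lemma koszul_sign1 n (od : 'I_n -> bool) : koszul_sign R od 1%g = 1.
Proof.
rewrite /koszul_sign big1 // => i _; rewrite big1 // => j.
by rewrite !perm1 => /andP[ij ji]; have := ltn_trans ij ji; rewrite ltnn.
Qed.

Lemma koszul_sign2 (od : 'I_2 -> bool) (s : 'S_2) (i0 := ord0 : 'I_2)
    (i1 := lift ord0 ord0 : 'I_2) :
  koszul_sign R od s = if (s i1 < s i0)%N then (-1) ^+ (od (s i0) && od (s i1)) else 1.
Proof.
rewrite /koszul_sign !big_ord_recl big_ord0 !(big_mkcond (fun j => _ && _)) !big_ord_recl.
by rewrite !big_ord0 /= !mul1r !mulr1.
Qed.

Lemma koszul_sign3 (od : 'I_3 -> bool) (s : 'S_3) (i0 := ord0 : 'I_3) (i1 := lift ord0 ord0 : 'I_3)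
    (i2 := lift ord0 (lift ord0 ord0) : 'I_3)
    (sg := fun i j => if (s j < s i)%N then (-1) ^+ (od (s i) && od (s j)) else 1 : R) :
  koszul_sign R od s = sg i0 i1 * sg i0 i2 * sg i1 i2.
Proof.
rewrite /koszul_sign !big_ord_recl big_ord0 !(big_mkcond (fun j => _ && _)) !big_ord_recl.
by rewrite !big_ord0 /= !mul1r !mulr1.
Qed.

End KoszulSigns.

Lemma enum_I0 : enum 'I_0 = [::].
Proof. by apply: size0nil; rewrite size_enum_ord. Qed.

Lemma enum_I1 : enum 'I_1 = [:: ord0].
Proof. by rewrite enum_ordSl enum_I0. Qed.

Lemma enum_I2 : enum 'I_2 = [:: ord0; lift ord0 ord0].
Proof. by rewrite enum_ordSl enum_I1. Qed.

Lemma enum_I3 : enum 'I_3 = [:: ord0; lift ord0 ord0; lift ord0 (lift ord0 ord0)].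
Proof. by rewrite enum_ordSl enum_I2. Qed.

(** * Insertion of forms with components of arity one and two *)

Section Insertions.
Variables (R : realType) (C : comAlgType R) (L : lmodType C).
Local Notation mv := (multivector L).
Implicit Types (P Q T : mv).

Definition form12 (A : mv -> mv) (B : mv -> mv -> mv) : vform L := fun Ps =>
  match Ps with [:: P] => A P | [:: P; Q] => B P Q | _ => 0 end.

Variables (A : mv -> mv) (B : mv -> mv -> mv) (A' : mv -> mv) (B' : mv -> mv -> mv).
Hypotheses (A'0 : A' 0 = 0) (B'0 : forall P, B' 0 P = 0).
Local Notation K := (form12 A B).
Local Notation F := (form12 A' B').

Lemma form12_0 Ps : F (0 :: Ps) = 0.
Proof. by case: Ps => [|P [|Q Ps]] /=; rewrite ?A'0 ?B'0. Qed.

Let term (n : nat) (Ps : 'I_n -> mv) (od : 'I_n -> bool) (k : nat) (s : 'S_n) : mv :=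
  let Qs := [seq Ps (s i) | i <- enum 'I_n] in
  koszul_sign R od s *: F (K (take k Qs) :: drop k Qs).

(** K vanishes unless it receives k = 1 or 2 arguments, and F, which receives n - k + 1, unless n -
    k is 0 or 1. A vanishing K leaves 0 in the first slot of F, whence [A'0] and [B'0]. *)
Lemma form12_term0 n (Ps : 'I_n -> mv) od k s : (k <= n)%N ->
  (k == 0%N) || (2 < k)%N || (k.+1 < n)%N -> term Ps od k s = 0.
Proof.
move=> kn; rewrite /term; set Qs := map _ _.
have sQ : size Qs = n by rewrite size_map size_enum_ord.
case/orP => [/orP[/eqP ->|k2]|k1].
- by rewrite take0 form12_0 scaler0.
- rewrite (_ : K _ = 0) ?form12_0 ?scaler0 //.
  have : size (take k Qs) = k by rewrite size_takel ?sQ.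
  by case: (take k Qs) => [|? [|? [|? ?]]] //= sk; rewrite -sk in k2.
rewrite (_ : F _ = 0) ?scaler0 //.
have : size (drop k Qs) = (n - k)%N by rewrite size_drop sQ.
case: (drop k Qs) => [|? [|? ?]] //= /esym/eqP; first by rewrite subn_eq0 leqNgt ltnW.
by rewrite -(eqn_add2r k) subnK // add1n => /eqP nk; rewrite nk ltnn in k1.
Qed.

Lemma sum_terms n (Ps : 'I_n.+1 -> mv) od :
  \sum_(k < n.+2) \sum_(s : 'S_n.+1 | is_unshuffle k s) term Ps od k s =
  \sum_(j < n.+1) term Ps od n (lift_perm ord_max j 1%g) + term Ps od n.+1 1%g.
Proof.
rewrite [LHS]big_ord_recr [X in X + _ = _]big_ord_recr /= big1 ?add0r => [|k _]; last first.
  apply: big1 => s _; apply: form12_term0 => /=.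
    exact: leq_trans (ltnW (ltn_ord k)) (leqnSn n).
  by rewrite ltnS ltn_ord !orbT.
rewrite sum_unshuffle_last; congr (_ + _).
rewrite (eq_bigl (pred1 1%g)) ?big_pred1_eq //.
by move=> s; rewrite unshuffle_full.
Qed.

Lemma insertion_nil : insertion K F [::] = 0.
Proof.
rewrite /insertion big1 // => o _; rewrite big1 // => k _; rewrite big1 // => s _.
apply: (form12_term0 (fun i => parity_part (o i) (nth 0 [::] i)) o s).
  by rewrite -ltnS.
by case: k => -[].
Qed.

Let part (Ps : seq mv) (o : {ffun 'I_(size Ps) -> bool}) i := parity_part (o i) (nth 0 Ps i).

Lemma insertion_cons P Ps (n := size Ps) : insertion K F (P :: Ps) =
  \sum_(o : {ffun 'I_n.+1 -> bool})
    (\sum_(j < n.+1) term (part (Ps := P :: Ps) o) o n (lift_perm ord_max j 1%g)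
      + term (part (Ps := P :: Ps) o) o n.+1 1%g).
Proof. by apply: eq_bigr => o _; exact: (sum_terms (part (Ps := P :: Ps) o) o). Qed.

Lemma insertion1 P :
  insertion K F [:: P] = \sum_(o : {ffun 'I_1 -> bool}) A' (A (parity_part (o ord0) P)).
Proof.
rewrite insertion_cons; apply: eq_bigr => o _.
rewrite big1 ?add0r => [|j _]; last exact: form12_term0.
by rewrite /term koszul_sign1 scale1r enum_I1 /= perm1 /part /=.
Qed.

Lemma insertion2 P Q (i0 := ord0 : 'I_2) (i1 := lift ord0 ord0 : 'I_2) :
  insertion K F [:: P; Q] = \sum_(o : {ffun 'I_2 -> bool})
    let P0 := parity_part (o i0) P in let P1 := parity_part (o i1) Q in
    ((-1) ^+ (o i0 && o i1) *: B' (A P1) P0 + B' (A P0) P1 + A' (B P0 P1)).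
Proof.
rewrite insertion_cons; apply: eq_bigr => o _.
have vE (s : 'S_2) (i j : 'I_2) : s i = j :> nat -> s i = j by apply: val_inj.
have e00 : lift_perm ord_max i0 1%g i0 = i1 by apply: vE; rewrite lift_perm_max_val.
have e01 : lift_perm ord_max i0 1%g i1 = i0 by apply: vE; rewrite lift_perm_max_val.
have e10 : lift_perm ord_max i1 1%g i0 = i0 by apply: vE; rewrite lift_perm_max_val.
have e11 : lift_perm ord_max i1 1%g i1 = i1 by apply: vE; rewrite lift_perm_max_val.
rewrite !big_ord_recl big_ord0 addr0; congr (_ + _ + _);
  rewrite /term ?koszul_sign1 ?koszul_sign2 enum_I2 /=.
- by rewrite e00 e01 /= andbC.
- by rewrite e10 e11 /= scale1r.
by rewrite !perm1 scale1r.
Qed.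

Lemma insertion3 P Q T (i0 := ord0 : 'I_3) (i1 := lift ord0 ord0 : 'I_3)
    (i2 := lift ord0 (lift ord0 ord0) : 'I_3) :
  insertion K F [:: P; Q; T] = \sum_(o : {ffun 'I_3 -> bool})
    let P0 := parity_part (o i0) P in let P1 := parity_part (o i1) Q in
    let P2 := parity_part (o i2) T in
    ((-1) ^+ (o i1 && o i0) * (-1) ^+ (o i2 && o i0) *: B' (B P1 P2) P0
     + (-1) ^+ (o i2 && o i1) *: B' (B P0 P2) P1 + B' (B P0 P1) P2).
Proof.
rewrite insertion_cons; apply: eq_bigr => o _.
have vE (s : 'S_3) (i j : 'I_3) : s i = j :> nat -> s i = j by apply: val_inj.
have e00 : lift_perm ord_max i0 1%g i0 = i1 by apply: vE; rewrite lift_perm_max_val.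
have e01 : lift_perm ord_max i0 1%g i1 = i2 by apply: vE; rewrite lift_perm_max_val.
have e02 : lift_perm ord_max i0 1%g i2 = i0 by apply: vE; rewrite lift_perm_max_val.
have e10 : lift_perm ord_max i1 1%g i0 = i0 by apply: vE; rewrite lift_perm_max_val.
have e11 : lift_perm ord_max i1 1%g i1 = i2 by apply: vE; rewrite lift_perm_max_val.
have e12 : lift_perm ord_max i1 1%g i2 = i1 by apply: vE; rewrite lift_perm_max_val.
have e20 : lift_perm ord_max i2 1%g i0 = i0 by apply: vE; rewrite lift_perm_max_val.
have e21 : lift_perm ord_max i2 1%g i1 = i1 by apply: vE; rewrite lift_perm_max_val.
have e22 : lift_perm ord_max i2 1%g i2 = i2 by apply: vE; rewrite lift_perm_max_val.
rewrite [X in _ + X]form12_term0 // addr0.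
rewrite !big_ord_recl big_ord0 addr0 addrA; congr (_ + _ + _);
  rewrite /term koszul_sign3 enum_I3 /=.
- by rewrite e00 e01 e02 /= mul1r.
- by rewrite e10 e11 e12 /= !mul1r.
by rewrite e20 e21 e22 /= !mul1r scale1r.
Qed.

Lemma insertion_long Ps : (3 < size Ps)%N -> insertion K F Ps = 0.
Proof.
case: Ps => [|P Ps] //= n3; rewrite insertion_cons big1 // => o _.
rewrite big1 ?add0r => [|j _]; first by apply: form12_term0; rewrite ?(ltnW n3) ?orbT.
by apply: form12_term0; rewrite // [(2 < _)%N]n3 orbT.
Qed.

End Insertions.

Section ParitySums.
Variables (R : realType) (C : comAlgType R) (L : lmodType C).
Local Notation mv := (multivector L).
Implicit Types (P Q T : mv).

Lemma parity_part_pure b P : pure b (parity_part b P).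
Proof. by move=> s sb; rewrite /= (negPf sb). Qed.

Lemma parity_partD P : P = parity_part true P + parity_part false P.
Proof. by apply: mv_ext => s; rewrite mvD /=; case: odd; rewrite /= ?addr0 ?add0r. Qed.

Lemma parity_partB P : parity_part true P - parity_part false P = - sgn P.
Proof.
apply: mv_ext => s; rewrite mvD !mvN /= /sgn_form -signr_odd; case: odd.
  by rewrite /= expr1 mulN1r opprK subr0.
by rewrite /= expr0 mul1r add0r.
Qed.

(** For additive maps, the sum over parities in [insertion] reassembles each argument from its even
    and odd parts. *)
Lemma parity_sum1 (H : mv -> mv) P : (forall P Q, H (P + Q) = H P + H Q) ->
  \sum_(o : {ffun 'I_1 -> bool}) H (parity_part (o ord0) P) = H P.
Proof.
move=> HD; rewrite (reindex_onto (fun b : bool => [ffun=> b]) (fun o => o ord0)) /=.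
  rewrite (eq_bigl predT) => [|b]; last by rewrite ffunE eqxx.
  by rewrite big_bool /= !ffunE -HD -parity_partD.
by move=> o _; apply/ffunP => i; rewrite ffunE [i]ord1.
Qed.

Lemma parity_sum2 (H : mv -> mv -> mv) P Q (i0 := ord0 : 'I_2) (i1 := lift ord0 ord0 : 'I_2) :
  (forall P Q T, H (P + Q) T = H P T + H Q T) ->
  (forall P Q T, H T (P + Q) = H T P + H T Q) ->
  \sum_(o : {ffun 'I_2 -> bool}) H (parity_part (o i0) P) (parity_part (o i1) Q) = H P Q.
Proof.
move=> HDl HDr.
rewrite (reindex_onto (fun b : bool * bool => [ffun i => if i == i0 then b.1 else b.2])
  (fun o => (o i0, o i1))) /=.
  rewrite (eq_bigl predT) => [|[b c]]; last by rewrite !ffunE /= eqxx.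
  pose o b c : {ffun 'I_2 -> bool} := [ffun i => if i == i0 then (b, c).1 else (b, c).2].
  rewrite -(pair_big predT predT
    (fun b c => H (parity_part (o b c i0) P) (parity_part (o b c i1) Q))) /=.
  by rewrite !big_bool /= !ffunE /= -!HDr -HDl -!parity_partD.
move=> o _; apply/ffunP => i; rewrite ffunE /=.
case: (unliftP i0 i) => [j ->|->]; last by rewrite eqxx.
by rewrite [j]ord1.
Qed.

End ParitySums.

(** * The associated homotopy structures *)

Section HomotopyStructures.
Variables (R : realType) (C : comAlgType R) (L : lmodType C).
Local Notation mv := (multivector L).
Implicit Types (X Y Z : L) (f g : C) (P Q T pi : mv).
Implicit Types (br : L -> L -> L) (rho : L -> C -> C) (N M : {linear L -> L}).
Hypothesis hL : fg_projective L.

(** Degrees are integers; below -2 no length fits and only 0 remains. *)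
Lemma has_degreeP d P : has_degree d P ->
  P = 0 \/ exists p : nat, d = p%:Z - 2 /\ homogeneous p P.
Proof.
move=> dP; have [[p dp]|np] := pselect (exists p : nat, d = p%:Z - 2).
  right; exists p; split=> // s sp; apply: dP; rewrite dp.
  by apply: contraNN sp => /eqP/addIr [->].
left; apply: mv_ext => s; apply: dP; apply/eqP => ds; apply: np.
by exists (size s).
Qed.

Lemma homogeneous_has_degree p P : homogeneous p P -> has_degree (p%:Z - 2) P.
Proof. by move=> hP s sp; apply: hP; apply: contraNN sp => /eqP ->. Qed.

Lemma has_degree_pure d P : has_degree d P -> pure (odd `|d|%N) P.
Proof.
case/has_degreeP => [->|[p [-> hP]]]; first exact: pure0.
have -> : odd `|p%:Z - 2|%N = odd p; last exact: homogeneous_pure.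
case: p {hP} => [|[|p]] //.
by rewrite -addn2 PoszD addrK absz_nat oddD addbF.
Qed.

Lemma sign_int (d d' : int) : (-1 : R) ^ (d * d') = (-1) ^+ (odd `|d|%N && odd `|d'|%N).
Proof.
have e k : (-1 : R) ^ k = (-1) ^+ odd `|k|%N.
  case: k => k /=; first by rewrite -exprnP signr_odd.
  by rewrite NegzE -exprnN invr_sign -[LHS]signr_odd.
by rewrite e abszM oddM.
Qed.

Lemma form12_symmetric (e : int) (A : mv -> mv) (B : mv -> mv -> mv) :
  (forall (c : R) P Q, A (c *: P + Q) = c *: A P + A Q) ->
  (forall (c : R) P Q T, B (c *: P + Q) T = c *: B P T + B Q T) ->
  (forall (c : R) P Q T, B T (c *: P + Q) = c *: B T P + B T Q) ->
  (forall b c P Q, pure b P -> pure c Q -> B P Q = (-1) ^+ (b && c) *: B Q P) ->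
  (forall p P, homogeneous p P -> has_degree (p%:Z - 2 + e) (A P)) ->
  (forall p q P Q, homogeneous p P -> homogeneous q Q ->
    has_degree ((p%:Z - 2) + (q%:Z - 2) + e) (B P Q)) ->
  is_symmetric_vform e (form12 A B).
Proof.
move=> Al Bl Br Bs Ad Bd.
have A0 : A 0 = 0 by exact: linear_map0 Al.
have B0l T : B 0 T = 0 by apply: (linear_map0 (A := B^~ T)).
have B0r T : B T 0 = 0 by exact: (linear_map0 (A := B T)).
split.
- move=> s t c P Q; case: s => [|P1 [|P2 s]].
  + by case: t => [|Q1 [|Q2 t]] /=; rewrite ?Al ?Bl // scaler0 addr0.
  + by case: t => [|Q1 t] /=; rewrite ?Br // scaler0 addr0.
  by case: s => [|P3 s] /=; rewrite scaler0 addr0.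
- move=> s t d d' P Q /has_degree_pure Pd /has_degree_pure Qd.
  case: s => [|P1 [|P2 s]]; last by case: s => [|P3 s] /=; rewrite scaler0.
    case: t => [|Q1 t] /=; last by rewrite scaler0.
    by rewrite (Bs _ _ _ _ Pd Qd) sign_int.
  by rewrite /= scaler0.
move=> [|d1 [|d2 [|d3 ds]]] [|P1 [|P2 [|P3 Ps]]] //= _ dPs.
  rewrite !big_cons big_nil addr0.
  have /has_degreeP[->|[p [-> hP]]] : has_degree d1 P1 := dPs 0%N isT; first by rewrite A0.
  exact: Ad.
rewrite !big_cons big_nil addr0.
have /has_degreeP[->|[p [-> hP]]] : has_degree d1 P1 := dPs 0%N isT; first by rewrite B0l.
have /has_degreeP[->|[q [-> hQ]]] : has_degree d2 P2 := dPs 1%N isT; first by rewrite B0r.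
exact: Bd.
Qed.

Lemma associatedE br rho pi : associated_linfty br rho pi =
  form12 (schouten br rho pi)
    (fun P Q => schouten br rho (parity_part true P) Q - schouten br rho (parity_part false P) Q).
Proof. by apply/funext => -[|P [|Q [|T Ps]]] /=; rewrite /associated_linfty /= ?addr0 ?add0r. Qed.

Section Associated.
Variables (br : L -> L -> L) (rho : L -> C -> C) (pi : mv).
Hypotheses (la : lie_algebroid br rho) (po : poisson br rho pi).
Let pla := la_pre la.
Local Notation S := (schouten br rho).

(** The sign (-1)^(p-1) of l_2 is minus the operator [sgn], which is defined on all multivectors and
    commutes with the extension of N. *)
Definition binary P Q : mv := - S (sgn P) Q.

Lemma associated_form12 : associated_linfty br rho pi = form12 (S pi) binary.
Proof.
rewrite associatedE; congr form12; apply/funext => P; apply/funext => Q.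
by rewrite /binary -[RHS](schoutenNl hL pla) -parity_partB (schoutenDl hL pla) (schoutenNl hL pla).
Qed.

Lemma binary_pure b P Q : pure b P -> binary P Q = (-1) ^+ (~~ b) *: S P Q.
Proof.
move=> Pb; rewrite /binary (sgn_pure Pb) (schoutenZl hL pla).
by case: b {Pb}; rewrite /= ?expr0 ?expr1 ?scale1r ?scaleN1r ?opprK.
Qed.

Lemma binary_linearl (c : R) P Q T : binary (c *: P + Q) T = c *: binary P T + binary Q T.
Proof. by rewrite /binary sgn_linear (schouten_comb_l hL pla) opprD scalerN. Qed.

Lemma binary_linearr (c : R) P Q T : binary T (c *: P + Q) = c *: binary T P + binary T Q.
Proof. by rewrite /binary (schouten_comb_r hL pla) opprD scalerN. Qed.

Lemma binaryDl P Q T : binary (P + Q) T = binary P T + binary Q T.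
Proof. by rewrite -[P]scale1r binary_linearl !scale1r. Qed.

Lemma binaryDr P Q T : binary T (P + Q) = binary T P + binary T Q.
Proof. by rewrite -[P]scale1r binary_linearr !scale1r. Qed.

Lemma binary_symmetric b c P Q : pure b P -> pure c Q ->
  binary P Q = (-1) ^+ (b && c) *: binary Q P.
Proof.
move=> Pb Qc; rewrite (binary_pure _ Pb) (binary_pure _ Qc) (schouten_skew hL pla Pb Qc).
by case: b c {Pb Qc} => -[]; sign_cases; apply: mv_ext => s; rewrite !mvE; ring.
Qed.

Let hpi : homogeneous 2 pi := po.1.
Let pipi : S pi pi = 0 := po.2.
Let pi_pure : pure false pi := homogeneous_pure hpi.

Lemma shift_degree (m n : nat) : m.+1 = n -> m%:Z = n%:Z - 1.
Proof. by move=> <-; rewrite -addn1 PoszD addrK. Qed.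

Lemma associated_symmetric : is_symmetric_vform 1 (associated_linfty br rho pi).
Proof.
rewrite associated_form12; apply: form12_symmetric.
- by move=> c P Q; rewrite (schouten_comb_r hL pla).
- exact: binary_linearl.
- exact: binary_linearr.
- exact: binary_symmetric.
- move=> p P hP s sp; apply: (schouten_degree hL pla hpi hP).
  by apply: contraNN sp => /eqP/shift_degree ->; rewrite PoszD; apply/eqP; ring.
move=> p q P Q hP hQ s spq; rewrite mvN (schouten_degree hL pla (p := p) (q := q)) ?oppr0 //.
  by move=> t tp; rewrite /= /sgn_form hP // mulr0.
by apply: contraNN spq => /eqP/shift_degree ->; rewrite PoszD; apply/eqP; ring.
Qed.

(** Half of the Richardson-Nijenhuis square. In arities one, two and three it is [pi, [pi, .]] = 0,
    the derivation property of [pi, .] and graded Jacobi, all instances of [schouten_jacobi]. *)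
Lemma insertion_associated Ps :
  insertion (associated_linfty br rho pi) (associated_linfty br rho pi) Ps = 0.
Proof.
rewrite associated_form12.
have A0 : S pi 0 = 0 by exact: schouten0r.
have B0 P : binary 0 P = 0 by rewrite /binary sgn0 (schouten0l hL pla) oppr0.
case: Ps => [|P [|Q [|T [|U Ps]]]].
- exact: insertion_nil.
- rewrite (insertion1 _ _ A0 B0); apply: big1 => o _; set P0 := parity_part _ P.
  have P0p : pure (o ord0) P0 by exact: parity_part_pure.
  (* As [pi, pi] = 0 and pi is even, Jacobi equates [pi, [pi, P]] with its own negative. *)
  have := schouten_jacobi hL la pi_pure pi_pure P0p.
  rewrite pipi (schouten0l hL pla) add0r expr1 scaleN1r => e.
  apply: mv_ext => s; rewrite mv0; apply: twice_eq0.
  by rewrite mulrDl mul1r {1}e mvN addNr.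
- rewrite (insertion2 _ _ A0 B0); apply: big1 => o _.
  have := @parity_part_pure _ _ _ (o ord0) P.
  have := @parity_part_pure _ _ _ (o (lift ord0 ord0)) Q.
  move: (o ord0) (o _) => b c /=.
  move: (parity_part b P) (parity_part c Q) => P0 P1 P1c P0b.
  have dP := schouten_pure hL pla pi_pure P0b; have dQ := schouten_pure hL pla pi_pure P1c.
  rewrite (binary_pure _ P0b) (binary_pure _ dP) (binary_pure _ dQ) (schoutenZr hL pla).
  rewrite (schouten_jacobi hL la pi_pure P0b P1c) (schouten_skew hL pla dQ P0b).
  by case: b c {P0b P1c dP dQ} => -[]; sign_cases; apply: mv_ext => s; rewrite !mvE; ring.
- rewrite (insertion3 _ _ A0 B0); apply: big1 => o _.
  have := @parity_part_pure _ _ _ (o ord0) P.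
  have := @parity_part_pure _ _ _ (o (lift ord0 ord0)) Q.
  have := @parity_part_pure _ _ _ (o (lift ord0 (lift ord0 ord0))) T.
  move: (o ord0) (o (lift ord0 ord0)) (o _) => b c d /=.
  move: (parity_part b P) (parity_part c Q) (parity_part d T) => P0 P1 P2 P2d P1c P0b.
  have P01 := schouten_pure hL pla P0b P1c; have P02 := schouten_pure hL pla P0b P2d.
  have P12 := schouten_pure hL pla P1c P2d.
  rewrite !(binary_pure _ P0b) !(binary_pure _ P1c).
  rewrite !(binary_pure _ (pureZ _ P01)) !(binary_pure _ (pureZ _ P02)).
  rewrite !(binary_pure _ (pureZ _ P12)).
  rewrite !(schoutenZl hL pla) (schouten_skew hL pla P12 P0b).
  rewrite (schouten_jacobi hL la P0b P1c P2d) (schouten_skew hL pla P02 P1c).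
  by case: b c d {P0b P1c P2d P01 P02 P12} => -[] []; rewrite -scalerA; sign_cases;
    apply: mv_ext => s; rewrite !mvE; ring.
exact: insertion_long.
Qed.

Lemma rn_bracket11 (K F : vform L) Ps :
  rn_bracket 1 1 K F Ps = insertion K F Ps + insertion F K Ps.
Proof. by rewrite /rn_bracket mulr1 expr1z scaleN1r opprK. Qed.

Lemma associated_linfty_structure : linfty_structure (associated_linfty br rho pi).
Proof.
split; first exact: associated_symmetric.
  by rewrite associatedE.
by move=> Ps; rewrite rn_bracket11 insertion_associated addr0.
Qed.

End Associated.

Section Nijenhuis.
Variables (br : L -> L -> L) (rho : L -> C -> C) (pi : mv) (N : {linear L -> L}).
Hypothesis pn : pn_pair br rho pi N.
Let la := pp_lie pn.
Let pla := la_pre la.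
Local Notation S := (schouten br rho).
Local Notation brN := (deformed_br br N).
Local Notation rhoN := (deformed_anchor rho N).
Local Notation D := (mder (lin_md N)).

Lemma sgn_mder P : sgn (D P) = D (sgn P).
Proof.
apply: mv_ext => s; rewrite /= -(der_form_sgn _ (md_linear (lin_md N))) //.
Qed.

Lemma derivation_form12 : unary_form (derivation_extension N) = form12 D (fun _ _ => 0).
Proof.
by rewrite (derivation_extensionE N hL); apply/funext => -[|P [|Q [|T Ps]]].
Qed.

Lemma derivation_symmetric : is_symmetric_vform 0 (unary_form (derivation_extension N)).
Proof.
rewrite derivation_form12; apply: form12_symmetric => //.
- exact: mder_linear.
- by move=> *; rewrite scaler0 addr0.
- by move=> *; rewrite scaler0 addr0.
- by move=> *; rewrite scaler0.
move=> p P hP; rewrite addr0; apply: homogeneous_has_degree.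
exact: lin_md_homogeneous.
Qed.

Lemma rn_derivation_associated :
  rn_bracket 0 1 (unary_form (derivation_extension N)) (associated_linfty br rho pi) =
  associated_linfty brN rhoN (- pi).
Proof.
have plaN := deformed_pre hL N pla.
have laN := deformed_lie hL la (pp_nijenhuis pn).
rewrite derivation_form12 (associated_form12 _ la) (associated_form12 _ laN).
have A0 : S pi 0 = 0 by exact: schouten0r.
have B0 P : binary br rho 0 P = 0 by rewrite /binary sgn0 (schouten0l hL pla) oppr0.
have D0 : D 0 = 0 by exact: mder0.
apply/funext => Ps; rewrite /rn_bracket mul0r expr0z scale1r.
case: Ps => [|P [|Q [|T [|U Ps]]]].
- by rewrite !insertion_nil ?subr0.
- have H1 (P1 P2 : mv) : S pi (D (P1 + P2)) = S pi (D P1) + S pi (D P2).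
    by rewrite mderD (schoutenDr hL pla).
  have H2 (P1 P2 : mv) : D (S pi (P1 + P2)) = D (S pi P1) + D (S pi P2).
    by rewrite (schoutenDr hL pla) mderD.
  rewrite !insertion1 //; have /= -> := parity_sum1 P H1; have /= -> := parity_sum1 P H2.
  rewrite /= (schoutenNl hL plaN) (bivectorN_schouten hL pn).
  (* [e] will read [pi_N, P] = 2 [pi_N, P] + [pi, N P] - N [pi, P], which yields the minus sign. *)
  have /= := deformed_schouten hL N pi P pla; rewrite (bivectorN_schouten hL pn) (lin_md_pi hL pn).
  rewrite (schoutenZl hL pla) => e; apply/eqP; rewrite -subr_eq0 opprK.
  rewrite -(subrr (S (bivector_N pi N) P)) {2}e scaler_nat mulr2n; apply/eqP.
  by apply: mv_ext => s; rewrite !mvE; ring.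
- rewrite !insertion2 // -sumrB.
  pose H P Q := binary br rho (D P) Q + binary br rho P (D Q) - D (binary br rho P Q).
  rewrite -[RHS](_ : H P Q = _); last first.
    rewrite /H /= /binary sgn_mder (deformed_schouten hL N _ _ pla) mderN.
    by apply: mv_ext => s; rewrite !mvE; ring.
  rewrite -(parity_sum2 (H := H)).
  + apply: eq_bigr => o _ /=; rewrite A0 scaler0 addr0 !add0r /H.
    set P0 := parity_part _ P; set P1 := parity_part _ Q.
    have P0p : pure (o ord0) P0 by exact: parity_part_pure.
    have P1p : pure (o (lift ord0 ord0)) P1 by exact: parity_part_pure.
    (* Inserting N into the second argument moves it to the front; symmetry moves it back and
       absorbs the Koszul sign. *)
    rewrite -(binary_symmetric la P0p (pure_mder _ P1p)).
    by rewrite [X in X - _]addrC.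
  + move=> P1 P2 T; rewrite /H mderD !(binaryDl la) mderD.
    by apply: mv_ext => s; rewrite !mvE; ring.
  move=> P1 P2 T; rewrite /H mderD !(binaryDr la) mderD.
  by apply: mv_ext => s; rewrite !mvE; ring.
- rewrite !insertion3 // !big1 ?subr0 // => o _ /=.
    by rewrite !scaler0 !addr0.
  by rewrite !B0 !scaler0 !addr0.
by rewrite !insertion_long ?subr0.
Qed.

End Nijenhuis.
End HomotopyStructures.

(** * Compatible structures and the weak Nijenhuis condition *)

Section WeakNijenhuis.
Variables (R : realType) (C : comAlgType R) (L : lmodType C).
Local Notation mv := (multivector L).
Implicit Types (P Q T pi : mv) (K F : vform L).
Implicit Types (br : L -> L -> L) (rho : L -> C -> C) (N M : {linear L -> L}).
Hypothesis hL : fg_projective L.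

Lemma insertionDr K F1 F2 Ps :
  insertion K (F1 \+ F2) Ps = insertion K F1 Ps + insertion K F2 Ps.
Proof.
rewrite /insertion -big_split /=; apply: eq_bigr => o _.
rewrite -big_split /=; apply: eq_bigr => k _.
by rewrite -big_split /=; apply: eq_bigr => s _; rewrite scalerDr.
Qed.

Lemma insertionDl K1 K2 F Ps :
  (forall P Q s, F (P + Q :: s) = F (P :: s) + F (Q :: s)) ->
  insertion (K1 \+ K2) F Ps = insertion K1 F Ps + insertion K2 F Ps.
Proof.
move=> FD; rewrite /insertion -big_split /=; apply: eq_bigr => o _.
rewrite -big_split /=; apply: eq_bigr => k _.
by rewrite -big_split /=; apply: eq_bigr => s _; rewrite /= FD scalerDr.
Qed.

Lemma symmetric_vform_add e F P Q s : is_symmetric_vform e F ->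
  F (P + Q :: s) = F (P :: s) + F (Q :: s).
Proof. by move=> hF; have /= := vf_linear hF [::] s 1 P Q; rewrite !scale1r. Qed.

(* Polarisation: the two structures add up to the one associated to br1 + br2. *)
Lemma associated_compatible br1 rho1 br2 rho2 pi :
  let br X Y := br1 X Y + br2 X Y in
  let rho X f := rho1 X f + rho2 X f in
  lie_algebroid br1 rho1 -> lie_algebroid br2 rho2 -> lie_algebroid br rho ->
  poisson br1 rho1 pi -> poisson br2 rho2 pi ->
  forall Ps, rn_bracket 1 1 (associated_linfty br1 rho1 pi) (associated_linfty br2 rho2 pi) Ps = 0.
Proof.
move=> br rho la1 la2 la po1 po2 Ps; rewrite rn_bracket11.
have SD P Q : schouten br rho P Q = schouten br1 rho1 P Q + schouten br2 rho2 P Q.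
  exact: add_schouten (la_pre la1) (la_pre la2) (la_pre la).
have po : poisson br rho pi.
  by split; [exact: po1.1|rewrite SD po1.2 po2.2 addr0].
set mu1 := associated_linfty br1 _ _; set mu2 := associated_linfty br2 _ _.
have muE : associated_linfty br rho pi = mu1 \+ mu2.
  apply/funext => -[|P [|Q [|T Qs]]];
    rewrite /mu1 /mu2 /associated_linfty /l1 /l2 /= ?SD ?addr0 ?add0r //.
  by apply: mv_ext => s; rewrite !mvE; ring.
have D1 := symmetric_vform_add _ _ _ (associated_symmetric hL la1 po1).
have D2 := symmetric_vform_add _ _ _ (associated_symmetric hL la2 po2).
have D P Q s : (mu1 \+ mu2) (P + Q :: s) = (mu1 \+ mu2) (P :: s) + (mu1 \+ mu2) (Q :: s).
  by rewrite /= /mu1 /mu2 D1 D2 addrACA.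
(* Of the four terms of the expanded insertion, the two squares vanish; the mixed ones make up the
   bracket of two forms of degree 1. *)
have := insertion_associated hL la po Ps; rewrite muE (insertionDl mu1 mu2 _ D).
rewrite (insertionDr mu1 mu1 mu2) (insertionDr mu2 mu1 mu2).
by rewrite !insertion_associated // add0r addr0.
Qed.

End WeakNijenhuis.

Theorem proposition2p7p14 (R : realType) (C : comAlgType R) (L : lmodType C)
    (hL : fg_projective L)
    (br : L -> L -> L) (rho : L -> C -> C) (hA : lie_algebroid br rho)
    (pi : multivector L) (N : {linear L -> L})
    (hPN : poisson_nijenhuis br rho pi N) :
  let mu := associated_linfty br rho pi in
  let NN := unary_form (derivation_extension N) in
  let brN := deformed_br br N in
  let rhoN := deformed_anchor rho N in
  let piN := bivector_N pi N in
  [/\ linfty_structure mu,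
      weak_nijenhuis mu NN
    & [/\ lie_algebroid brN rhoN,
          poisson brN rhoN (- piN) /\ poisson br rho (- piN),
          linfty_structure (rn_bracket 0 1 NN mu),
          rn_bracket 0 1 NN mu =1 l1 br rho (- piN) \+ l2 brN rhoN
        & poisson brN rhoN (- pi) /\
          rn_bracket 0 1 NN mu =1 associated_linfty brN rhoN (- pi)]].
Proof.
move=> mu NN brN rhoN piN.
have pla := la_pre hA; have pn := (pn_pairP hL pi N hA).1 hPN.
have pnN := opp_pair hL (deformed_pair hL pn).
have pnNN := opp_pair hL (deformed_pair hL pnN).
have poissonP br1 rho1 pi1 : pn_pair br1 rho1 pi1 N -> poisson br1 rho1 pi1.
  move=> p; apply/(poissonE hL _ (la_pre (pp_lie p))).
  by split; [exact: pp_homogeneous p|exact: pp_poisson p].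
have poN := poissonP _ _ _ pnN.
have laN := pp_lie pnN; have plaN := la_pre laN.
have muN : rn_bracket 0 1 NN mu = associated_linfty brN rhoN (- pi).
  exact: rn_derivation_associated.
split.
- exact: (associated_linfty_structure hL hA (poissonP _ _ _ pn)).
- split; first exact: derivation_symmetric.
  have nN := pp_nijenhuis pn.
  move=> Ps; rewrite muN (rn_derivation_associated hL pnN) opprK.
  (* The two signs cancel, and the twice deformed bracket becomes a deformation of [br] by the
     single tensor N^2, as [add_deformed_lie] demands. *)
  move: pnNN; rewrite opprK (deformed_twice hL pla nN) => pnNN.
  apply: (associated_compatible hL hA (pp_lie pnNN)); try exact: poissonP.
  exact: add_deformed_lie (pp_lie pnNN).
split=> //.
- have pnP := bivectorN_pair hL pn; split; apply: poissonP.
    exact: opp_pair (deformed_pair hL pnP).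
  exact: opp_pair pnP.
- by rewrite muN; exact: associated_linfty_structure.
(* The bracket with -pi_N in the unary part is that of [br]. Taken in [brN] instead, it would be
   [-pi, .] for the bracket deformed by N^2, by [bivectorN_schouten] for the deformed pair. *)
- move=> Ps; rewrite muN /associated_linfty /=; congr (_ + _).
  case: Ps => [|P [|Q Ps]] //=.
  rewrite (schoutenNl hL plaN) (bivectorN_schouten hL pn) (schoutenNl hL pla) //.
by split=> // Ps; rewrite muN.
Qed.
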